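(* Let $\Bbbk$ be any commutative ring, let $\mathcal B$ and $\mathcal C$ be $\Bbbk$-linear bicategories, and let $\mathsf{PsFun}_\Bbbk(\mathcal B,\mathcal C)$ be the $\Bbbk$-linear bicategory of $\Bbbk$-linear pseudofunctors $\mathcal B\to\mathcal C$. If $\mathcal C$ is Krull--Schmidt and $\mathcal B$ has finitely many equivalence classes of objects, then $\mathsf{PsFun}_\Bbbk(\mathcal B,\mathcal C)$ is Krull--Schmidt.
   Context: A bicategory is $\Bbbk$-linear if its Hom categories and composition functors are $\Bbbk$-linear (enriched in $\Bbbk$-modules). A pseudofunctor $\mathcal F\colon\mathcal B\to\mathcal C$ between $\Bbbk$-linear bicategories is $\Bbbk$-linear if each functor $\mathcal B(X,Y)\to\mathcal C(\mathcal FX,\mathcal FY)$ is $\Bbbk$-linear. $\mathsf{PsFun}_\Bbbk(\mathcal B,\mathcal C)$ has $\Bbbk$-linear pseudofunctors as objects, pseudonatural transformations as 1-cells and modifications as 2-cells. A bicategory is locally additive if every Hom category is additive and every composition functor is additive in both variables. In a locally additive bicategory, a direct sum of objects $X_1,\dots,X_n$ is an object $X$ with 1-cells $I_i\colon X_i\to X$, $P_i\colon X\to X_i$ such that there exist isomorphisms $P_iI_i\cong \mathrm{Id}_{X_i}$, $P_iI_j\cong 0$ for $i\neq j$, and $\bigoplus_i I_iP_i\cong \mathrm{Id}_X$; the direct sum of no objects is a zero object (both initial and final, in the pseudo sense). A bicategory is additive if it is locally additive and admits all finite direct sums of objects. A nonzero object $X$ is strongly indecomposable if the commutative ring $\mathrm{End}(\mathrm{Id}_X)$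 of 2-cells $\mathrm{Id}_X\Rightarrow\mathrm{Id}_X$ is connected (nonzero, with only idempotents $0,1$). An additive bicategory is Krull--Schmidt if every nonzero object is equivalent to a direct sum of finitely many strongly indecomposable objects. *)

(* Defs.v *)
From HB Require Import structures.
From mathcomp Require Import all_boot all_algebra.
From mathcomp Require Import boolp.

Set Implicit Arguments.
Unset Strict Implicit.
Unset Printing Implicit Defensive.
Import GRing.Theory.
Local Open Scope ring_scope.

Declare Scope bicat_scope.
Delimit Scope bicat_scope with bicat.
Local Open Scope bicat_scope.

Record lincat (k : comPzRingType) := LinCat {
  lob :> Type;
  lhom : lob -> lob -> lmodType k;
  lid : forall a, lhom a a;
  lcomp : forall a b c, lhom b c -> lhom a b -> lhom a c;
  lcompA : forall a b c d (h : lhom c d) (g : lhom b c) (f : lhom a b),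
    lcomp h (lcomp g f) = lcomp (lcomp h g) f;
  lcomp1f : forall a b (f : lhom a b), lcomp (lid b) f = f;
  lcompf1 : forall a b (f : lhom a b), lcomp f (lid a) = f;
  lcomp_linearl : forall a b c (f : lhom a b),
    linear (fun g : lhom b c => lcomp g f);
  lcomp_linearr : forall a b c (g : lhom b c),
    linear (fun f : lhom a b => lcomp g f)
}.
Arguments lhom {k l} a b.
Arguments lid {k l} a.
Arguments lcomp {k l a b c} g f.

Notation "a ~> b" := (lhom a b) (at level 70, no associativity) : bicat_scope.
Notation "g \v f" := (lcomp g f) (at level 51, right associativity) : bicat_scope.

Record liniso (k : comPzRingType) (C : lincat k) (a b : C) := LinIso {
  fwd : a ~> b;
  bwd : b ~> a;
  fwdK : bwd \v fwd = lid a;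
  bwdK : fwd \v bwd = lid b
}.

Definition isomorphic (k : comPzRingType) (C : lincat k) (a b : C) : Prop :=
  inhabited (liniso a b).

Definition zero_ob (k : comPzRingType) (C : lincat k) (z : C) : Prop :=
  forall a : C, (exists! f : z ~> a, True) /\ (exists! f : a ~> z, True).

Definition dirsum (k : comPzRingType) (C : lincat k) (n : nat)
    (a : 'I_n -> C) (s : C) : Prop :=
  exists (inj : forall i, a i ~> s) (proj : forall i, s ~> a i),
    [/\ forall i, proj i \v inj i = lid (a i),
        forall i j, i != j -> proj i \v inj j = 0
      & \sum_(i < n) (inj i \v proj i) = lid s].

Definition additive_cat (k : comPzRingType) (C : lincat k) : Prop :=
  forall (n : nat) (a : 'I_n -> C), exists s : C, dirsum a s.

(* Up to equivalence, the terminal category. *)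
Definition trivial_cat (k : comPzRingType) (C : lincat k) : Prop :=
  inhabited C /\ forall a b : C, exists! f : a ~> b, True.

Record linfunctor (k : comPzRingType) (C D : lincat k) := LinFunctor {
  fob :> C -> D;
  fmap : forall a b : C, (a ~> b) -> (fob a ~> fob b);
  fmap1 : forall a, fmap (lid a) = lid (fob a);
  fmapM : forall a b c (g : b ~> c) (f : a ~> b),
    fmap (g \v f) = fmap g \v fmap f;
  fmap_linear : forall a b, linear (@fmap a b)
}.
Arguments fmap {k C D} l {a b} f.

(* Functors C x D -> E that are k-linear in each variable. *)
Record bifunctor (k : comPzRingType) (C D E : lincat k) := BiFunctor {
  bifob :> C -> D -> E;
  bimap : forall (a a' : C) (b b' : D),
    (a ~> a') -> (b ~> b') -> (bifob a b ~> bifob a' b');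
  bimap1 : forall a b, bimap (lid a) (lid b) = lid (bifob a b);
  bimapM : forall a a' a'' b b' b''
      (u' : a' ~> a'') (u : a ~> a') (v' : b' ~> b'') (v : b ~> b'),
    bimap (u' \v u) (v' \v v) = bimap u' v' \v bimap u v;
  bimap_linearl : forall a a' b b' (v : b ~> b'),
    linear (fun u : a ~> a' => bimap u v);
  bimap_linearr : forall a a' b b' (u : a ~> a'),
    linear (fun v : b ~> b' => bimap u v)
}.
Arguments bimap {k C D E} b {a a' b0 b'} u v : rename.

Record bicat (k : comPzRingType) := BiCat {
  ob :> Type;
  hom1 : ob -> ob -> lincat k;
  id1 : forall X, hom1 X X;
  comp1 : forall X Y Z, bifunctor (hom1 Y Z) (hom1 X Y) (hom1 X Z);
  assoc : forall X Y Z W (h : hom1 Z W) (g : hom1 Y Z) (f : hom1 X Y),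
    liniso (comp1 X Y W (comp1 Y Z W h g) f)
           (comp1 X Z W h (comp1 X Y Z g f));
  lunit : forall X Y (f : hom1 X Y), liniso (comp1 X Y Y (id1 Y) f) f;
  runit : forall X Y (f : hom1 X Y), liniso (comp1 X X Y f (id1 X)) f;
  assoc_nat : forall X Y Z W (h h' : hom1 Z W) (g g' : hom1 Y Z)
      (f f' : hom1 X Y) (u : h ~> h') (v : g ~> g') (w : f ~> f'),
    fwd (assoc h' g' f') \v bimap (comp1 X Y W) (bimap (comp1 Y Z W) u v) w =
    bimap (comp1 X Z W) u (bimap (comp1 X Y Z) v w) \v fwd (assoc h g f);
  lunit_nat : forall X Y (f f' : hom1 X Y) (u : f ~> f'),
    fwd (lunit f') \v bimap (comp1 X Y Y) (lid (id1 Y)) u =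
    u \v fwd (lunit f);
  runit_nat : forall X Y (f f' : hom1 X Y) (u : f ~> f'),
    fwd (runit f') \v bimap (comp1 X X Y) u (lid (id1 X)) =
    u \v fwd (runit f);
  pentagon : forall V X Y Z W (l : hom1 Z W) (h : hom1 Y Z) (g : hom1 X Y)
      (f : hom1 V X),
    fwd (assoc l h (comp1 V X Y g f)) \v fwd (assoc (comp1 Y Z W l h) g f) =
    bimap (comp1 V Z W) (lid l) (fwd (assoc h g f))
      \v fwd (assoc l (comp1 X Y Z h g) f)
      \v bimap (comp1 V X W) (fwd (assoc l h g)) (lid f);
  triangle : forall X Y Z (g : hom1 Y Z) (f : hom1 X Y),
    bimap (comp1 X Y Z) (lid g) (fwd (lunit f)) \v fwd (assoc g (id1 Y) f) =
    bimap (comp1 X Y Z) (fwd (runit g)) (lid f)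
}.
Arguments hom1 {k b} X Y.
Arguments id1 {k b} X.
Arguments comp1 {k b X Y Z}.
Arguments assoc {k b X Y Z W} h g f.
Arguments lunit {k b X Y} f.
Arguments runit {k b X Y} f.

Notation "g \c f" := (comp1 g f) (at level 45, right associativity) : bicat_scope.
Notation "v \h u" := (bimap comp1 v u) (at level 48, left associativity) : bicat_scope.

Section BicategoryNotions.
Context {k : comPzRingType} {B : bicat k}.
Implicit Types X Y : B.

Definition equivalent X Y : Prop :=
  exists (f : hom1 X Y) (g : hom1 Y X),
    isomorphic (g \c f) (id1 X) /\ isomorphic (f \c g) (id1 Y).

(* Initial and final in the pseudo sense. *)
Definition zero_object X : Prop :=
  forall Y, trivial_cat (hom1 X Y) /\ trivial_cat (hom1 Y X).

Definition object_dirsum (n : nat) (A : 'I_n -> B) (X : B) : Prop :=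
  exists (I : forall i, hom1 (A i) X) (P : forall i, hom1 X (A i)),
    [/\ forall i, isomorphic (P i \c I i) (id1 (A i)),
        forall i j, i != j ->
          exists2 z : hom1 (A j) (A i), zero_ob z & isomorphic (P i \c I j) z
      & exists2 s : hom1 X X,
          dirsum (fun i => I i \c P i) s & isomorphic s (id1 X)].

(* The commutative ring End(Id_X) is connected; its product is \v. *)
Definition strongly_indecomposable X : Prop :=
  [/\ ~ zero_object X, lid (id1 X) <> 0
    & forall e : id1 X ~> id1 X, e \v e = e -> e = 0 \/ e = lid (id1 X)].

End BicategoryNotions.

(* Composition of 1-cells, being k-linear in each variable, is automatically
   additive in both variables. *)
Definition locally_additive (k : comPzRingType) (B : bicat k) : Prop :=
  forall X Y : B, additive_cat (hom1 X Y).

Definition additive_bicat (k : comPzRingType) (B : bicat k) : Prop :=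
  locally_additive B /\
  forall (n : nat) (A : 'I_n -> B), exists X : B, object_dirsum A X.

Definition krull_schmidt (k : comPzRingType) (B : bicat k) : Prop :=
  additive_bicat B /\
  forall X : B, ~ zero_object X ->
    exists (n : nat) (A : 'I_n -> B) (S : B),
      [/\ forall i, strongly_indecomposable (A i), object_dirsum A S
        & equivalent X S].

Definition finitely_many_classes (k : comPzRingType) (B : bicat k) : Prop :=
  exists (n : nat) (A : 'I_n -> B), forall X : B, exists i, equivalent X (A i).

Record pseudofunctor (k : comPzRingType) (B C : bicat k) := PseudoFunctor {
  pfob :> B -> C;
  pfhom : forall X Y : B, linfunctor (hom1 X Y) (hom1 (pfob X) (pfob Y));
  pfcomp : forall X Y Z (g : hom1 Y Z) (f : hom1 X Y),
    liniso (pfhom Y Z g \c pfhom X Y f) (pfhom X Z (g \c f));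
  pfunit : forall X, liniso (id1 (pfob X)) (pfhom X X (id1 X));
  pfcomp_nat : forall X Y Z (g g' : hom1 Y Z) (f f' : hom1 X Y)
      (v : g ~> g') (u : f ~> f'),
    fwd (pfcomp g' f') \v (fmap (pfhom Y Z) v \h fmap (pfhom X Y) u) =
    fmap (pfhom X Z) (v \h u) \v fwd (pfcomp g f);
  pfassoc : forall X Y Z W (h : hom1 Z W) (g : hom1 Y Z) (f : hom1 X Y),
    fmap (pfhom X W) (fwd (assoc h g f)) \v fwd (pfcomp (h \c g) f)
      \v (fwd (pfcomp h g) \h lid (pfhom X Y f)) =
    fwd (pfcomp h (g \c f)) \v (lid (pfhom Z W h) \h fwd (pfcomp g f))
      \v fwd (assoc (pfhom Z W h) (pfhom Y Z g) (pfhom X Y f));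
  pflunit : forall X Y (f : hom1 X Y),
    fmap (pfhom X Y) (fwd (lunit f)) \v fwd (pfcomp (id1 Y) f)
      \v (fwd (pfunit Y) \h lid (pfhom X Y f)) =
    fwd (lunit (pfhom X Y f));
  pfrunit : forall X Y (f : hom1 X Y),
    fmap (pfhom X Y) (fwd (runit f)) \v fwd (pfcomp f (id1 X))
      \v (lid (pfhom X Y f) \h fwd (pfunit X)) =
    fwd (runit (pfhom X Y f))
}.
Arguments pfhom {k B C} p {X Y}.
Arguments pfcomp {k B C} p {X Y Z} g f.
Arguments pfunit {k B C} p X.

Record pseudonat (k : comPzRingType) (B C : bicat k) (F G : pseudofunctor B C)
  := PseudoNat {
  pnob :> forall X : B, hom1 (F X) (G X);
  pncell : forall (X Y : B) (f : hom1 X Y),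
    liniso (pfhom G f \c pnob X) (pnob Y \c pfhom F f);
  pn_nat : forall (X Y : B) (f f' : hom1 X Y) (u : f ~> f'),
    fwd (pncell f') \v (fmap (pfhom G) u \h lid (pnob X)) =
    (lid (pnob Y) \h fmap (pfhom F) u) \v fwd (pncell f);
  pn_unit : forall X : B,
    fwd (pncell (id1 X)) \v (fwd (pfunit G X) \h lid (pnob X)) =
    (lid (pnob X) \h fwd (pfunit F X))
      \v bwd (runit (pnob X)) \v fwd (lunit (pnob X));
  pn_comp : forall (X Y Z : B) (g : hom1 Y Z) (f : hom1 X Y),
    fwd (pncell (g \c f)) \v (fwd (pfcomp G g f) \h lid (pnob X)) =
    (lid (pnob Z) \h fwd (pfcomp F g f))
      \v fwd (assoc (pnob Z) (pfhom F g) (pfhom F f))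
      \v (fwd (pncell g) \h lid (pfhom F f))
      \v bwd (assoc (pfhom G g) (pnob Y) (pfhom F f))
      \v (lid (pfhom G g) \h fwd (pncell f))
      \v fwd (assoc (pfhom G g) (pfhom G f) (pnob X))
}.
Arguments pncell {k B C F G} p {X Y} f.

Definition is_modification (k : comPzRingType) (B C : bicat k)
    (F G : pseudofunctor B C) (s t : pseudonat F G)
    (m : forall X : B, s X ~> t X) : Prop :=
  forall (X Y : B) (f : hom1 X Y),
    fwd (pncell t f) \v (lid (pfhom G f) \h m X) =
    (m Y \h lid (pfhom F f)) \v fwd (pncell s f).

Record modification (k : comPzRingType) (B C : bicat k)
    (F G : pseudofunctor B C) (s t : pseudonat F G) := Modification {
  mdob :> forall X : B, s X ~> t X;
  mdP : is_modification mdob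
}.

Section CategoryLemmas.
Context {k : comPzRingType} {C : lincat k}.
Implicit Types a b c d : C.

Definition liniso_inv a b (i : liniso a b) : liniso b a :=
  LinIso (bwdK i) (fwdK i).

Lemma lcomp_eql a b c d (g : c ~> d) (f : b ~> c) (h : b ~> d) :
  g \v f = h -> forall e : a ~> b, g \v f \v e = h \v e.
Proof. by move=> <- e; rewrite lcompA. Qed.

Lemma lcomp_eql3 a b c d d' (h : d ~> d') (g : c ~> d) (f : b ~> c)
    (r : b ~> d') :
  h \v g \v f = r -> forall e : a ~> b, h \v g \v f \v e = r \v e.
Proof. by move=> <- e; rewrite !lcompA. Qed.

Lemma liniso_comp_fwdK a b c (j : liniso b c) (i : liniso a b) :
  (bwd i \v bwd j) \v fwd j \v fwd i = lid a.
Proof. by rewrite -lcompA (lcompA (bwd j)) fwdK lcomp1f fwdK. Qed.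

Definition liniso_comp a b c (j : liniso b c) (i : liniso a b) : liniso a c :=
  @LinIso _ _ _ _ (fwd j \v fwd i) (bwd i \v bwd j)
    (liniso_comp_fwdK j i)
    (liniso_comp_fwdK (liniso_inv i) (liniso_inv j)).

Lemma fwdKl a b d (i : liniso a b) (f : d ~> a) : bwd i \v fwd i \v f = f.
Proof. by rewrite lcompA fwdK lcomp1f. Qed.

Lemma bwdKl a b d (i : liniso a b) (f : d ~> b) : fwd i \v bwd i \v f = f.
Proof. by rewrite lcompA bwdK lcomp1f. Qed.

Lemma fwd_monic a b d (i : liniso a b) (f g : d ~> a) :
  fwd i \v f = fwd i \v g -> f = g.
Proof. by move=> E; rewrite -(fwdKl i f) E fwdKl. Qed.

Lemma fwd_epic a b d (i : liniso a b) (f g : b ~> d) :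
  f \v fwd i = g \v fwd i -> f = g.
Proof.
by move=> E; rewrite -(lcompf1 f) -(bwdK i) lcompA E -lcompA bwdK lcompf1.
Qed.

(* Inverts two opposite invertible sides of a commutative square. *)
Lemma square_inv a a' b b' (i : liniso a a') (j : liniso b b')
    (f : a ~> b) (g : a' ~> b') :
  fwd j \v f = g \v fwd i -> f \v bwd i = bwd j \v g.
Proof.
move=> E; apply: (fwd_monic (i := j)); rewrite bwdKl lcompA E -lcompA bwdK.
by rewrite lcompf1.
Qed.

End CategoryLemmas.

Section BicategoryLemmas.
Context {k : comPzRingType} {C : bicat k}.
Implicit Types X Y Z W V : C.

Lemma whisk1 X Y Z (g : hom1 Y Z) (f : hom1 X Y) :
  lid g \h lid f = lid (g \c f).
Proof. exact: bimap1. Qed.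

Lemma whiskl X Y Z (g : hom1 Y Z) (f f' f'' : hom1 X Y) (v : f' ~> f'')
    (u : f ~> f') :
  lid g \h (v \v u) = (lid g \h v) \v (lid g \h u).
Proof. by rewrite -bimapM lcomp1f. Qed.

Lemma whiskr X Y Z (f : hom1 X Y) (g g' g'' : hom1 Y Z) (v : g' ~> g'')
    (u : g ~> g') :
  (v \v u) \h lid f = (v \h lid f) \v (u \h lid f).
Proof. by rewrite -bimapM lcomp1f. Qed.

Lemma exchange X Y Z (f f' : hom1 X Y) (g g' : hom1 Y Z) (v : g ~> g')
    (u : f ~> f') :
  (v \h lid f') \v (lid g \h u) = (lid g' \h u) \v (v \h lid f).
Proof. by rewrite -!bimapM !lcomp1f !lcompf1. Qed.

Lemma liniso_h_fwdK X Y Z (g g' : hom1 Y Z) (f f' : hom1 X Y)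
    (j : liniso g g') (i : liniso f f') :
  (bwd j \h bwd i) \v (fwd j \h fwd i) = lid (g \c f).
Proof. by rewrite -bimapM !fwdK bimap1. Qed.

Definition liniso_h X Y Z (g g' : hom1 Y Z) (f f' : hom1 X Y)
    (j : liniso g g') (i : liniso f f') : liniso (g \c f) (g' \c f') :=
  @LinIso _ _ _ _ (fwd j \h fwd i) (bwd j \h bwd i)
    (liniso_h_fwdK j i) (liniso_h_fwdK (liniso_inv j) (liniso_inv i)).

Definition liniso1 (D : lincat k) (a : D) : liniso a a :=
  @LinIso _ _ _ _ (lid a) (lid a) (lcomp1f (lid a)) (lcomp1f (lid a)).

Definition lwhisk X Y Z (g : hom1 Y Z) (f f' : hom1 X Y) (i : liniso f f') :=
  liniso_h (liniso1 g) i.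

Definition rwhisk X Y Z (f : hom1 X Y) (g g' : hom1 Y Z) (i : liniso g g') :=
  liniso_h i (liniso1 f).

Lemma assoc_nat_bwd X Y Z W (h h' : hom1 Z W) (g g' : hom1 Y Z)
    (f f' : hom1 X Y) (u : h ~> h') (v : g ~> g') (w : f ~> f') :
  bwd (assoc h' g' f') \v (u \h (v \h w)) =
  ((u \h v) \h w) \v bwd (assoc h g f).
Proof. by apply/esym/square_inv/assoc_nat. Qed.

Lemma lunit_nat_bwd X Y (f f' : hom1 X Y) (u : f ~> f') :
  bwd (lunit f') \v u = (lid (id1 Y) \h u) \v bwd (lunit f).
Proof. by apply/esym/square_inv/lunit_nat. Qed.

Lemma runit_nat_bwd X Y (f f' : hom1 X Y) (u : f ~> f') :
  bwd (runit f') \v u = (u \h lid (id1 X)) \v bwd (runit f).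
Proof. by apply/esym/square_inv/runit_nat. Qed.

Lemma lwhisk_id_inj X Y (f f' : hom1 X Y) (u v : f ~> f') :
  lid (id1 Y) \h u = lid (id1 Y) \h v -> u = v.
Proof.
move=> E; apply: (fwd_epic (i := lunit f)).
by rewrite -!lunit_nat E.
Qed.

Lemma rwhisk_id_inj X Y (f f' : hom1 X Y) (u v : f ~> f') :
  u \h lid (id1 X) = v \h lid (id1 X) -> u = v.
Proof.
move=> E; apply: (fwd_epic (i := runit f)).
by rewrite -!runit_nat E.
Qed.

Section Pentagons.
Context {V X Y Z W : C}.
Context (l : hom1 Z W) (h : hom1 Y Z) (g : hom1 X Y) (f : hom1 V X).

Lemma pentagon_bwd :
  (bwd (assoc l h g) \h lid f) \v bwd (assoc l (h \c g) f)
    \v (lid l \h bwd (assoc h g f)) =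
  bwd (assoc (l \c h) g f) \v bwd (assoc l h (g \c f)).
Proof.
pose i := liniso_comp (lwhisk l (assoc h g f))
            (liniso_comp (assoc l (h \c g) f) (rwhisk f (assoc l h g))).
pose j := liniso_comp (assoc l h (g \c f)) (assoc (l \c h) g f).
have E : fwd j = fwd i by exact: pentagon.
have -> : bwd (assoc (l \c h) g f) \v bwd (assoc l h (g \c f)) = bwd j by [].
rewrite lcompA.
have -> : ((bwd (assoc l h g) \h lid f) \v bwd (assoc l (h \c g) f))
    \v (lid l \h bwd (assoc h g f)) = bwd i by [].
apply: (fwd_monic (i := j)); by rewrite {1}E !bwdK.
Qed.

Lemma pentagon2 :
  (fwd (assoc l h g) \h lid f) \v bwd (assoc (l \c h) g f) =
  bwd (assoc l (h \c g) f) \v (lid l \h bwd (assoc h g f))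
    \v fwd (assoc l h (g \c f)).
Proof.
apply: (fwd_monic (i := rwhisk f (liniso_inv (assoc l h g)))) => /=.
rewrite (lcompA (bwd _ \h _)) -whiskr fwdK whisk1 lcomp1f.
by rewrite (lcompA _ _ (fwd _)) (lcompA _ (_ \v _) (fwd _)) pentagon_bwd -lcompA
  fwdK lcompf1.
Qed.

Lemma pentagon3 :
  fwd (assoc (l \c h) g f) \v (bwd (assoc l h g) \h lid f)
    \v bwd (assoc l (h \c g) f) =
  bwd (assoc l h (g \c f)) \v (lid l \h fwd (assoc h g f)).
Proof.
apply: (fwd_monic (i := liniso_inv (assoc (l \c h) g f))) => /=.
rewrite fwdKl.
rewrite (lcompA _ _ (lid l \h _)) -pentagon_bwd -!lcompA -whiskl fwdK whisk1.
by rewrite lcompf1.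
Qed.

Lemma pentagon4 :
  (lid l \h bwd (assoc h g f)) \v fwd (assoc l h (g \c f))
    \v fwd (assoc (l \c h) g f) =
  fwd (assoc l (h \c g) f) \v (fwd (assoc l h g) \h lid f).
Proof. by rewrite pentagon lcompA -whiskl fwdK whisk1 lcomp1f. Qed.

Lemma pentagon5 :
  fwd (assoc l h (g \c f)) \v fwd (assoc (l \c h) g f)
    \v (bwd (assoc l h g) \h lid f) =
  (lid l \h fwd (assoc h g f)) \v fwd (assoc l (h \c g) f).
Proof.
by rewrite lcompA pentagon -!lcompA -whiskr bwdK whisk1 lcompf1.
Qed.

End Pentagons.

Lemma lunit_comp X Y Z (g : hom1 Y Z) (f : hom1 X Y) :
  fwd (lunit (g \c f)) \v fwd (assoc (id1 Z) g f) = fwd (lunit g) \h lid f.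
Proof.
apply: lwhisk_id_inj.
apply: (fwd_epic (i := liniso_comp (assoc (id1 Z) (id1 Z \c g) f)
  (rwhisk f (assoc (id1 Z) (id1 Z) g)))) => /=.
rewrite whiskl -lcompA -pentagon lcompA triangle.
by rewrite -whisk1 -assoc_nat (lcompA (lid _ \h _)) -assoc_nat -lcompA -whiskr triangle.
Qed.

Lemma runit_comp X Y Z (g : hom1 Y Z) (f : hom1 X Y) :
  (lid g \h fwd (runit f)) \v fwd (assoc g f (id1 X)) = fwd (runit (g \c f)).
Proof.
apply: rwhisk_id_inj; apply: (fwd_monic (i := assoc g f (id1 X))).
rewrite whiskr lcompA assoc_nat -lcompA -triangle whiskl -lcompA -pentagon.
by rewrite lcompA -assoc_nat whisk1 -lcompA triangle.
Qed.

Lemma lunit_id1 X : fwd (lunit (id1 X)) = fwd (runit (id1 X)).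
Proof.
apply: rwhisk_id_inj; rewrite -triangle -lunit_comp; congr (_ \v _).
by apply: (fwd_monic (i := lunit (id1 X))); rewrite lunit_nat.
Qed.

Lemma lunit_comp_bwd X Y Z (g : hom1 Y Z) (f : hom1 X Y) :
  (fwd (lunit g) \h lid f) \v bwd (assoc (id1 Z) g f) = fwd (lunit (g \c f)).
Proof. by rewrite -lunit_comp -lcompA bwdK lcompf1. Qed.

Lemma runit_comp_bwd X Y Z (g : hom1 Y Z) (f : hom1 X Y) :
  fwd (runit (g \c f)) \v bwd (assoc g f (id1 X)) = lid g \h fwd (runit f).
Proof. by rewrite -runit_comp -lcompA bwdK lcompf1. Qed.

Lemma triangle_bwd X Y Z (g : hom1 Y Z) (f : hom1 X Y) :
  (fwd (runit g) \h lid f) \v bwd (assoc g (id1 Y) f) = lid g \h fwd (lunit f).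
Proof. by rewrite -triangle -lcompA bwdK lcompf1. Qed.

End BicategoryLemmas.

Lemma lcomp0l (k : comPzRingType) (D : lincat k) (a b c : D) (f : a ~> b) : (0 : b ~> c) \v f = 0.
Proof.
have := lcomp_linearl (c := c) f (-1) 0 0.
by rewrite scaler0 addr0 scaleN1r addNr.
Qed.

Lemma lcomp0r (k : comPzRingType) (D : lincat k) (a b c : D) (g : b ~> c) : g \v (0 : a ~> b) = 0.
Proof.
have := lcomp_linearr (a := a) g (-1) 0 0.
by rewrite scaler0 addr0 scaleN1r addNr.
Qed.

Lemma bimap0l (k : comPzRingType) (D D' E : lincat k) (H : bifunctor D D' E) (a a' : D) (b b' : D')
    (v : b ~> b') : bimap H (0 : a ~> a') v = 0.
Proof.
have := bimap_linearl H (a := a) (a' := a') v (-1) 0 0.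
by rewrite scaler0 addr0 scaleN1r addNr.
Qed.

Lemma bimap0r (k : comPzRingType) (D D' E : lincat k) (H : bifunctor D D' E) (a a' : D) (b b' : D')
    (u : a ~> a') : bimap H u (0 : b ~> b') = 0.
Proof.
have := bimap_linearr H (b := b) (b' := b') u (-1) 0 0.
by rewrite scaler0 addr0 scaleN1r addNr.
Qed.

Lemma object_dirsum0 (k : comPzRingType) (B : bicat k) (A : 'I_0 -> B) (X : B) :
  locally_additive B -> object_dirsum A X <-> zero_object X.
Proof.
move=> addB; split=> [[I [P [_ _ [s [inj [proj [_ _ s0]]] [i]]]]]|X0].
  have id0 : lid (id1 X) = 0.
    rewrite -(bwdK i) -(lcomp1f (bwd i)) -s0 big_ord0.
    by rewrite lcomp0l lcomp0r.
  have triv (D : lincat k) : additive_cat D -> (forall a : D, lid a = 0) ->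
      trivial_cat D.
    move=> /(_ 0 (fun o : 'I_0 => match notF (ltn_ord o) with end)) [z _] D0.
    split; first exact: inhabits z.
    move=> a b; exists 0; split=> // f _.
    by rewrite -(lcomp1f f) D0 lcomp0l.
  move=> Y; split; apply: triv; try exact: addB.
  - move=> f; rewrite -(bwdK (runit f)) -(lcomp1f (bwd _)) -whisk1 id0.
    by rewrite bimap0r lcomp0l lcomp0r.
  - move=> f; rewrite -(bwdK (lunit f)) -(lcomp1f (bwd _)) -whisk1 id0.
    by rewrite bimap0l lcomp0l lcomp0r.
have noI (i : 'I_0) : False by case: i.
exists (fun i => match noI i with end), (fun i => match noI i with end).
split=> [i|i|]; [by case: (noI i) | by case: (noI i) |].
have [s sP] := addB X X 0 (fun i => match noI i return hom1 X X with end).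
have [_ uniq] := (X0 X).1.
exists s.
  have -> : (fun i => match noI i return hom1 (A i) X with end
    \c match noI i return hom1 X (A i) with end) =
    (fun i => match noI i return hom1 X X with end).
    by apply: functional_extensionality_dep => i; case: (noI i).
  exact: sP.
have eq (a b : hom1 X X) (u v : a ~> b) : u = v.
  by have [w [_ wP]] := uniq a b; rewrite -(wP u) // -(wP v).
have [u _] := uniq s (id1 X); have [v _] := uniq (id1 X) s.
by constructor; exists u v; apply: eq.
Qed.

Section Modifications.
Context {k : comPzRingType} {B C : bicat k} {F G : pseudofunctor B C}.
Implicit Types s t r q : pseudonat F G.

Lemma modification_eq s t (m n : modification s t) :
  (forall X, m X = n X) -> m = n.
Proof.
case: m n => [m mP] [n nP] /= E.
have {}E : m = n by apply: functional_extensionality_dep.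
by subst n; congr Modification; apply: Prop_irrelevance.
Qed.

Lemma mod0P s t : is_modification (fun X => 0 : s X ~> t X).
Proof. by move=> X Y f; rewrite bimap0r bimap0l lcomp0l lcomp0r. Qed.

Lemma mod_linearP s t (a : k) (m n : modification s t) :
  is_modification (fun X => a *: m X + n X).
Proof.
move=> X Y f; rewrite (bimap_linearr _ _ a (m X)) lcomp_linearr.
by rewrite (bimap_linearl _ _ a (m Y)) lcomp_linearl !mdP.
Qed.

Definition mod0 s t : modification s t := Modification (@mod0P s t).

Lemma mod_addP s t (m n : modification s t) :
  is_modification (fun X => m X + n X).
Proof.
by move=> X Y f; have := mod_linearP 1 m n f; rewrite !scale1r.
Qed.

Lemma mod_scaleP s t (a : k) (m : modification s t) :
  is_modification (fun X => a *: m X).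
Proof.
by move=> X Y f; have := mod_linearP a m (mod0 s t) f; rewrite !addr0.
Qed.

Lemma mod_oppP s t (m : modification s t) : is_modification (fun X => - m X).
Proof.
by move=> X Y f; have := mod_scaleP (-1) m f; rewrite !scaleN1r.
Qed.

Definition mod_add s t (m n : modification s t) := Modification (mod_addP m n).
Definition mod_scale s t a (m : modification s t) :=
  Modification (mod_scaleP a m).
Definition mod_opp s t (m : modification s t) := Modification (mod_oppP m).

HB.instance Definition _ s t := gen_eqMixin (modification s t).
HB.instance Definition _ s t := gen_choiceMixin (modification s t).

Lemma mod_addA s t : associative (@mod_add s t).
Proof. by move=> m n p; apply: modification_eq => X; apply: addrA. Qed.

Lemma mod_addC s t : commutative (@mod_add s t).
Proof. by move=> m n; apply: modification_eq => X; apply: addrC. Qed.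

Lemma mod_add0 s t : left_id (mod0 s t) (@mod_add s t).
Proof. by move=> m; apply: modification_eq => X; apply: add0r. Qed.

Lemma mod_addN s t : left_inverse (mod0 s t) (@mod_opp s t) (@mod_add s t).
Proof. by move=> m; apply: modification_eq => X; apply: addNr. Qed.

HB.instance Definition _ s t := GRing.isZmodule.Build (modification s t)
  (@mod_addA s t) (@mod_addC s t) (@mod_add0 s t) (@mod_addN s t).

Lemma mod_scaleA s t a b (m : modification s t) :
  mod_scale a (mod_scale b m) = mod_scale (a * b) m.
Proof. by apply: modification_eq => X; apply: scalerA. Qed.

Lemma mod_scale1 s t : left_id 1 (@mod_scale s t).
Proof. by move=> m; apply: modification_eq => X; apply: scale1r. Qed.

Lemma mod_scaleDr s t : right_distributive (@mod_scale s t) +%R.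
Proof. by move=> a m n; apply: modification_eq => X; apply: scalerDr. Qed.

Lemma mod_scaleDl s t (m : modification s t) :
  {morph (@mod_scale s t)^~ m : a b / a + b}.
Proof. by move=> a b; apply: modification_eq => X; apply: scalerDl. Qed.

HB.instance Definition _ s t := GRing.Zmodule_isLmodule.Build k
  (modification s t) (@mod_scaleA s t) (@mod_scale1 s t) (@mod_scaleDr s t)
  (@mod_scaleDl s t).

Lemma mod_idP s : is_modification (fun X => lid (s X)).
Proof. by move=> X Y f; rewrite !whisk1 lcompf1 lcomp1f. Qed.

Definition mod_id s : modification s s := Modification (@mod_idP s).

Lemma mod_vcompP s t r (n : modification t r) (m : modification s t) :
  is_modification (fun X => n X \v m X).
Proof. by move=> X Y f; rewrite whiskl whiskr lcompA mdP -!lcompA mdP. Qed.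

Definition mod_vcomp s t r (n : modification t r) (m : modification s t) :
  modification s r := Modification (mod_vcompP n m).

Lemma mod_vcompA s t r q (p : modification r q) (n : modification t r)
    (m : modification s t) :
  mod_vcomp p (mod_vcomp n m) = mod_vcomp (mod_vcomp p n) m.
Proof. by apply: modification_eq => X; apply: lcompA. Qed.

Lemma mod_vcomp1f s t (m : modification s t) : mod_vcomp (mod_id t) m = m.
Proof. by apply: modification_eq => X; apply: lcomp1f. Qed.

Lemma mod_vcompf1 s t (m : modification s t) : mod_vcomp m (mod_id s) = m.
Proof. by apply: modification_eq => X; apply: lcompf1. Qed.

Lemma mod_vcomp_linearl s t r (m : modification s t) :
  linear (fun n : modification t r => mod_vcomp n m).
Proof.
move=> a n n'; apply: modification_eq => X.
exact: lcomp_linearl.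
Qed.

Lemma mod_vcomp_linearr s t r (n : modification t r) :
  linear (fun m : modification s t => mod_vcomp n m).
Proof.
move=> a m m'; apply: modification_eq => X.
exact: lcomp_linearr.
Qed.

End Modifications.

Definition psnat_cat (k : comPzRingType) (B C : bicat k)
    (F G : pseudofunctor B C) : lincat k :=
  @LinCat k (pseudonat F G) (fun s t => modification s t) (@mod_id _ _ _ F G)
    (@mod_vcomp _ _ _ F G) (@mod_vcompA _ _ _ F G) (@mod_vcomp1f _ _ _ F G)
    (@mod_vcompf1 _ _ _ F G) (@mod_vcomp_linearl _ _ _ F G)
    (@mod_vcomp_linearr _ _ _ F G).

Section ModificationIso.
Context {k : comPzRingType} {B C : bicat k} {F G : pseudofunctor B C}.
Context {s t : pseudonat F G} (i : forall X : B, liniso (s X) (t X)).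
Context (iP : is_modification (fun X => fwd (i X))).

Lemma mod_inverseP : is_modification (fun X => bwd (i X)).
Proof.
move=> X Y f; pose j := lwhisk (pfhom G f) (i X).
by apply: (square_inv (i := j) (j := rwhisk (pfhom F f) (i Y))); rewrite /= iP.
Qed.

Lemma mod_inverse_fwdK :
  mod_vcomp (Modification mod_inverseP) (Modification iP) = mod_id s.
Proof. by apply: modification_eq => X; apply: fwdK. Qed.

Lemma mod_inverse_bwdK :
  mod_vcomp (Modification iP) (Modification mod_inverseP) = mod_id t.
Proof. by apply: modification_eq => X; apply: bwdK. Qed.

Definition mod_iso : liniso (s : psnat_cat F G) t :=
  @LinIso k (psnat_cat F G) s t (Modification iP) (Modification mod_inverseP)
    mod_inverse_fwdK mod_inverse_bwdK.

End ModificationIso.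

Section IdentityTransformation.
Context {k : comPzRingType} {B C : bicat k} (F : pseudofunctor B C).

Definition pn_id_cell X Y (f : hom1 X Y) :
    liniso (pfhom F f \c id1 (F X)) (id1 (F Y) \c pfhom F f) :=
  liniso_comp (liniso_inv (lunit (pfhom F f))) (runit (pfhom F f)).

Lemma pn_id_nat (X Y : B) (f f' : hom1 X Y) (u : f ~> f') :
  fwd (pn_id_cell f') \v (fmap (pfhom F) u \h lid (id1 (F X))) =
  (lid (id1 (F Y)) \h fmap (pfhom F) u) \v fwd (pn_id_cell f).
Proof. by rewrite /= -lcompA runit_nat !lcompA lunit_nat_bwd. Qed.

Lemma pn_id_unit (X : B) :
  fwd (pn_id_cell (id1 X)) \v (fwd (pfunit F X) \h lid (id1 (F X))) =
  (lid (id1 (F X)) \h fwd (pfunit F X))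
    \v bwd (runit (id1 (F X))) \v fwd (lunit (id1 (F X))).
Proof.
rewrite /= -lcompA runit_nat lcompA lunit_nat_bwd -lcompA; congr (_ \v _).
by rewrite -lunit_id1 fwdK lunit_id1 fwdK.
Qed.

Lemma pn_id_comp (X Y Z : B) (g : hom1 Y Z) (f : hom1 X Y) :
  fwd (pn_id_cell (g \c f)) \v (fwd (pfcomp F g f) \h lid (id1 (F X))) =
  (lid (id1 (F Z)) \h fwd (pfcomp F g f))
    \v fwd (assoc (id1 (F Z)) (pfhom F g) (pfhom F f))
    \v (fwd (pn_id_cell g) \h lid (pfhom F f))
    \v bwd (assoc (pfhom F g) (id1 (F Y)) (pfhom F f))
    \v (lid (pfhom F g) \h fwd (pn_id_cell f))
    \v fwd (assoc (pfhom F g) (pfhom F f) (id1 (F X))).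
Proof.
rewrite /= -lcompA runit_nat lcompA lunit_nat_bwd -lcompA; congr (_ \v _).
rewrite whiskr whiskl -!lcompA.
rewrite (lcomp_eql (triangle_bwd _ _)).
rewrite (lcompA (lid _ \h _)) -whiskl bwdK whisk1 lcomp1f runit_comp.
rewrite lcompA; congr (_ \v _).
apply: (fwd_monic (i := lunit (pfhom F g \c pfhom F f))).
by rewrite bwdK lcompA lunit_comp -whiskr bwdK whisk1.
Qed.

Definition pn_id : pseudonat F F := PseudoNat pn_id_nat pn_id_unit pn_id_comp.

End IdentityTransformation.

Section Composition.
Context {k : comPzRingType} {B C : bicat k} {F G H : pseudofunctor B C}.

Section OneCells.
Context (s : pseudonat G H) (t : pseudonat F G).

Definition pn_comp_cell X Y (f : hom1 X Y) :
    liniso (pfhom H f \c (s X \c t X)) ((s Y \c t Y) \c pfhom F f) :=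
  liniso_comp (liniso_inv (assoc (s Y) (t Y) (pfhom F f)))
  (liniso_comp (lwhisk (s Y) (pncell t f))
  (liniso_comp (assoc (s Y) (pfhom G f) (t X))
  (liniso_comp (rwhisk (t X) (pncell s f))
               (liniso_inv (assoc (pfhom H f) (s X) (t X)))))).

Lemma pn_comp_nat (X Y : B) (f f' : hom1 X Y) (u : f ~> f') :
  fwd (pn_comp_cell f') \v (fmap (pfhom H) u \h lid (s X \c t X)) =
  (lid (s Y \c t Y) \h fmap (pfhom F) u) \v fwd (pn_comp_cell f).
Proof.
rewrite /= -!lcompA -!whisk1 assoc_nat_bwd (lcompA (_ \h lid (t X))) -whiskr.
rewrite pn_nat whiskr -lcompA (lcomp_eql (assoc_nat _ _ _)).
rewrite -lcompA (lcompA (lid (s Y) \h _)) -whiskl pn_nat whiskl -lcompA.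
by rewrite (lcomp_eql (assoc_nat_bwd _ _ _)) -lcompA.
Qed.

Lemma pn_comp_unit (X : B) :
  fwd (pn_comp_cell (id1 X)) \v (fwd (pfunit H X) \h lid (s X \c t X)) =
  (lid (s X \c t X) \h fwd (pfunit F X))
    \v bwd (runit (s X \c t X)) \v fwd (lunit (s X \c t X)).
Proof.
rewrite /= -!lcompA -!whisk1 assoc_nat_bwd (lcompA (_ \h lid (t X))) -whiskr.
rewrite pn_unit !whiskr -!lcompA lunit_comp_bwd.
rewrite (lcomp_eql (assoc_nat _ _ _)) -lcompA.
rewrite (lcompA (lid (s X) \h _)) -whiskl pn_unit !whiskl -!lcompA.
rewrite (lcomp_eql (assoc_nat_bwd _ _ _)) -lcompA; congr (_ \v _).
rewrite (lcomp_eql (triangle _ _)) (lcompA (_ \h lid _)) -whiskr bwdK whisk1.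
rewrite lcomp1f lcompA; congr (_ \v _).
apply: (fwd_monic (i := runit (s X \c t X))).
by rewrite bwdK lcompA runit_comp_bwd -whiskl bwdK whisk1.
Qed.

Lemma pn_comp_comp (X Y Z : B) (g : hom1 Y Z) (f : hom1 X Y) :
  fwd (pn_comp_cell (g \c f)) \v (fwd (pfcomp H g f) \h lid (s X \c t X)) =
  (lid (s Z \c t Z) \h fwd (pfcomp F g f))
    \v fwd (assoc (s Z \c t Z) (pfhom F g) (pfhom F f))
    \v (fwd (pn_comp_cell g) \h lid (pfhom F f))
    \v bwd (assoc (pfhom H g) (s Y \c t Y) (pfhom F f))
    \v (lid (pfhom H g) \h fwd (pn_comp_cell f))
    \v fwd (assoc (pfhom H g) (pfhom H f) (s X \c t X)).
Proof.
rewrite /= -!lcompA -!whisk1 assoc_nat_bwd (lcompA (_ \h lid (t X))) -whiskr.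
rewrite pn_comp !whiskr !whiskl -!lcompA.
rewrite (lcomp_eql (assoc_nat _ _ _)) -lcompA.
rewrite (lcompA (lid (s Z) \h fwd (pncell t _))) -whiskl pn_comp !whiskl -!lcompA.
rewrite (lcomp_eql3 (pentagon_bwd _ _ _ _)) -!lcompA.
rewrite (lcomp_eql (assoc_nat_bwd (lid (pfhom H g)) (lid (s Y)) _)) -!lcompA.
rewrite (lcomp_eql (esym (assoc_nat_bwd (fwd (pncell s g)) (lid (t Y)) _))) -!lcompA.
rewrite !whisk1 (lcomp_eql (exchange (fwd (pncell s g)) (fwd (pncell t f)))).
rewrite -!lcompA (lcomp_eql (pentagon2 _ _ _ _)) -!lcompA.
rewrite -(whisk1 (s Z) (pfhom G g)).
rewrite (lcomp_eql (assoc_nat (lid (s Z)) (lid (pfhom G g)) _)) -!lcompA.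
rewrite (lcomp_eql (esym (assoc_nat_bwd (lid (s Z)) (fwd (pncell t g)) _))) -!lcompA.
rewrite (lcomp_eql3 (pentagon3 _ _ _ _)) -!lcompA.
rewrite -(whisk1 (s Z) (t Z)).
rewrite (lcomp_eql (esym (assoc_nat_bwd (lid (s Z)) (lid (t Z)) _))) -!lcompA.
do 5 congr (_ \v _); last congr (_ \v _).
rewrite (lcomp_eql3 (esym (pentagon _ _ _ _))) -!lcompA pentagon2.
rewrite (lcomp_eql (esym (pentagon3 _ _ _ _))) -!lcompA.
rewrite (lcomp_eql (assoc_nat_bwd (lid (pfhom H g)) (fwd (pncell s f)) _)) -!lcompA.
rewrite -(whisk1 (pfhom G f) (t X)).
by rewrite (lcomp_eql (esym (assoc_nat (fwd (pncell s g)) _ _))) -!lcompA.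
Qed.

Definition pn_hcomp : pseudonat F H :=
  PseudoNat pn_comp_nat pn_comp_unit pn_comp_comp.

End OneCells.

Section TwoCells.
Context {s s' s'' : pseudonat G H} {t t' t'' : pseudonat F G}.

Lemma mod_hcompP (n : modification s s') (m : modification t t') :
  @is_modification _ _ _ _ _ (pn_hcomp s t) (pn_hcomp s' t')
    (fun X => n X \h m X).
Proof.
move=> X Y f; rewrite /= -!lcompA assoc_nat_bwd.
rewrite (lcompA (_ \h lid (t' X))) -bimapM mdP lcomp1f.
rewrite -[m X in LHS]lcompf1 bimapM -!lcompA (lcomp_eql (assoc_nat _ _ _)).
rewrite -!lcompA (lcompA (lid (s' Y) \h _)) -bimapM mdP lcomp1f.
rewrite -[n Y in LHS]lcompf1 bimapM -!lcompA.
by rewrite (lcomp_eql (assoc_nat_bwd _ _ _)) -!lcompA.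
Qed.

Definition mod_hcomp (n : modification s s') (m : modification t t') :
    modification (pn_hcomp s t) (pn_hcomp s' t') :=
  Modification (mod_hcompP n m).

Lemma mod_hcomp_linearl (m : modification t t') :
  linear (fun n : modification s s' => mod_hcomp n m).
Proof. by move=> a n n'; apply: modification_eq => X; apply: bimap_linearl. Qed.

Lemma mod_hcomp_linearr (n : modification s s') :
  linear (fun m : modification t t' => mod_hcomp n m).
Proof. by move=> a m m'; apply: modification_eq => X; apply: bimap_linearr. Qed.

End TwoCells.

Lemma mod_hcomp1 (s : pseudonat G H) (t : pseudonat F G) :
  mod_hcomp (mod_id s) (mod_id t) = mod_id (pn_hcomp s t).
Proof. by apply: modification_eq => X; apply: bimap1. Qed.

Lemma mod_hcompM (s s' s'' : pseudonat G H) (t t' t'' : pseudonat F G)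
    (n' : modification s' s'') (n : modification s s')
    (m' : modification t' t'') (m : modification t t') :
  mod_hcomp (mod_vcomp n' n) (mod_vcomp m' m) =
  mod_vcomp (mod_hcomp n' m') (mod_hcomp n m).
Proof. by apply: modification_eq => X; apply: bimapM. Qed.

Definition psnat_comp :
    bifunctor (psnat_cat G H) (psnat_cat F G) (psnat_cat F H) :=
  @BiFunctor k (psnat_cat G H) (psnat_cat F G) (psnat_cat F H) pn_hcomp
    (@mod_hcomp) mod_hcomp1 mod_hcompM (@mod_hcomp_linearl)
    (@mod_hcomp_linearr).

End Composition.

Section Constraints.
Context {k : comPzRingType} {B C : bicat k} {F G H K : pseudofunctor B C}.

Lemma psnat_assocP (r : pseudonat H K) (s : pseudonat G H) (t : pseudonat F G) :
  @is_modification _ _ _ _ _ (pn_hcomp (pn_hcomp r s) t)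
    (pn_hcomp r (pn_hcomp s t)) (fun X => fwd (assoc (r X) (s X) (t X))).
Proof.
move=> X Y f; rewrite /= !whiskl !whiskr -!lcompA.
rewrite (lcomp_eql (pentagon2 _ _ _ _)) -!lcompA -(whisk1 (r Y) (s Y)).
rewrite (lcomp_eql (assoc_nat (lid (r Y)) (lid (s Y)) _)) -!lcompA.
rewrite (lcomp_eql3 (pentagon5 _ _ _ _)) -!lcompA.
rewrite (lcomp_eql (assoc_nat (lid (r Y)) (fwd (pncell s f)) _)) -!lcompA.
rewrite -pentagon3 -(whisk1 (s X) (t X)).
rewrite (lcomp_eql (esym (assoc_nat (fwd (pncell r f)) _ _))) -!lcompA.
by rewrite (lcomp_eql3 (pentagon4 _ _ _ _)) -!lcompA.
Qed.

Lemma psnat_lunitP (t : pseudonat F G) :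
  @is_modification _ _ _ _ _ (pn_hcomp (pn_id G) t) t
    (fun X => fwd (lunit (t X))).
Proof.
move=> X Y f; rewrite /= (lcomp_eql (lunit_comp_bwd _ _)).
rewrite lcompA lunit_nat -!lcompA; congr (_ \v _).
by rewrite (lcomp_eql (lunit_comp _ _)) (lcompA (_ \h _)) -whiskr
  (lcompA (fwd _)) bwdK lcomp1f triangle_bwd.
Qed.

Lemma psnat_runitP (t : pseudonat F G) :
  @is_modification _ _ _ _ _ (pn_hcomp t (pn_id F)) t
    (fun X => fwd (runit (t X))).
Proof.
move=> X Y f; rewrite /= (lcomp_eql (triangle_bwd _ _)).
rewrite (lcompA (lid _ \h _)) -whiskl (lcompA (fwd _)) bwdK lcomp1f.
rewrite (lcomp_eql (runit_comp _ _)) lcompA runit_nat -lcompA.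
by rewrite runit_comp_bwd.
Qed.

Definition psnat_assoc (r : psnat_cat H K) (s : psnat_cat G H)
    (t : psnat_cat F G) :
  liniso (psnat_comp (psnat_comp r s) t) (psnat_comp r (psnat_comp s t)) :=
  mod_iso (psnat_assocP r s t).

Definition psnat_lunit (t : psnat_cat F G) :
  liniso (psnat_comp (pn_id G : psnat_cat G G) t) t :=
  mod_iso (psnat_lunitP t).

Definition psnat_runit (t : psnat_cat F G) :
  liniso (psnat_comp t (pn_id F : psnat_cat F F)) t :=
  mod_iso (psnat_runitP t).

End Constraints.

Definition PsFun (k : comPzRingType) (B C : bicat k) : bicat k.
Proof.
refine (@BiCat k (pseudofunctor B C) (@psnat_cat k B C) (@pn_id k B C)
  (fun F G H => @psnat_comp k B C F G H)
  (fun F G H K => @psnat_assoc k B C F G H K)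
  (fun F G => @psnat_lunit k B C F G)
  (fun F G => @psnat_runit k B C F G) _ _ _ _ _).
- abstract (by move=> F G H K *; apply: modification_eq => X; apply: assoc_nat).
- abstract (by move=> F G *; apply: modification_eq => X; apply: lunit_nat).
- abstract (by move=> F G *; apply: modification_eq => X; apply: runit_nat).
- abstract (by move=> E F G H K *; apply: modification_eq => X; apply: pentagon).
- abstract (by move=> F G H *; apply: modification_eq => X; apply: triangle).
Defined.

(* Main.v *)
From HB Require Import structures.
Require Import Defs.
From mathcomp Require Import all_boot all_algebra.
From mathcomp Require Import boolp.

Set Implicit Arguments.
Unset Strict Implicit.
Unset Printing Implicit Defensive.
Import GRing.Theory.
Local Open Scope ring_scope.
Local Open Scope bicat_scope.

(** Why the theorem holds.

    In a Krull-Schmidt bicategory [C] every object [X] is a direct sum of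
    strongly indecomposable objects [A_j].  An idempotent 2-cell of the identity
    of [X] restricts to an idempotent of each connected ring [End (Id_(A_j))],
    so to [0] or [1]: the idempotents of [End (Id_X)] are the sums of the
    projections onto some of the [A_j] ([idem_support_sum]), and each of them
    splits, the splitting object being the sum of the selected [A_j]
    ([split_idem]).

    An idempotent modification [u] of the identity of a pseudofunctor [F] is
    therefore given, object by object, by a subset of a finite set.  By
    naturality its component at [X] vanishes as soon as its component at an
    equivalent object does ([component_eq0_equiv]), so finitely many objects
    of [B] suffice to detect it: idempotents of [End (Id_F)] embed,
    multiplicatively, into the subsets of one finite set.  Hence [1] is a finite
    sum of orthogonal primitive idempotents ([primitive_decomposition]).  If
    these split in the bicategory of pseudofunctors, then [F] is the direct sum
    of the splitting objects ([split_dirsum]), and each of these is strongly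
    indecomposable because its ring [End (Id)] is the corner [p End (Id_F) p]
    cut out by a primitive [p] ([split_indecomposable]).

    It remains to build objects of the bicategory of pseudofunctors from
    pointwise ones.  Direct sums of pseudofunctors [O_i] and splittings of an
    idempotent modification are the same construction: an object [N] that is
    the sum of the images of idempotents [e_i] of [Id_(O_i)], which the record
    [blocks] expresses by 1-cells [a_i : O_i -> N] and [b_i : N -> O_i] with
    [a_i b_i] summing to [Id_N] and [b_i a_i] the image of [e_i].  If each
    [N X] is given such a structure, adjusted so that the unit
    [eta_i : Id -> a_i b_i] and the counit [eps_i : b_i a_i -> Id] satisfy the
    triangle identities ([adj_blocks_triangles]), then [f |-> a_i O_i(f) b_i] is
    a lax functor, as for every family of adjunctions; the sum over [i] of these
    lax functors is a pseudofunctor [N] ([block_functor]) and the [a_i], [b_i],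
    [eta_i], [eps_i] are pseudonatural, respectively modifications
    ([psfun_blocks]).

    The coherence computations all rest on one device.  Whiskering a 2-cell
    [u] by a 1-cell [w] on the right and moving all brackets to the right gives
    a 2-cell [hat u w]; the family of these determines [u] ([hat_inj]), and
    [hat] turns associators and unitors into identities.  After passing to
    [hat], an equation of pasted 2-cells is one of a strict 2-category. *)

(** * Strictification: right-bracketed whiskering *)
Section NormalForms.
Context {k : comPzRingType} {C : bicat k}.
Implicit Types X Y Z W : C.

(** A 1-cell with a chosen rebracketing of its composites with 1-cells [w] on
    its right, natural in [w].  The canonical instances below infer it from the
    shape of the 1-cell: a composite [g \c f] acts by [w |-> g (f w)], an
    identity by [w |-> w], any other 1-cell by composition. *)
Record nform X Y := NForm {
  nf_cell :> hom1 X Y;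
  act : forall W, hom1 W X -> hom1 W Y;
  nf_iso : forall W (w : hom1 W X), liniso (nf_cell \c w) (act w);
  actm : forall W (w w' : hom1 W X), (w ~> w') -> (act w ~> act w');
  nf_nat : forall W (w w' : hom1 W X) (v : w ~> w'),
    fwd (nf_iso w') \v (lid nf_cell \h v) = actm v \v fwd (nf_iso w)
}.

Lemma atom_nat X Y (f : hom1 X Y) W (w w' : hom1 W X) (v : w ~> w') :
  fwd (liniso1 (f \c w')) \v (lid f \h v) =
  (lid f \h v) \v fwd (liniso1 (f \c w)).
Proof. by rewrite lcomp1f lcompf1. Qed.

Canonical nf_atom X Y (f : hom1 X Y) : nform X Y :=
  @NForm X Y f (fun W w => f \c w) (fun W w => liniso1 (f \c w))
    (fun W w w' v => lid f \h v) (@atom_nat X Y f).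

Canonical nf_one X : nform X X :=
  @NForm X X (id1 X) (fun W w => w) (fun W w => lunit w)
    (fun W w w' v => v) (fun W w w' v => lunit_nat v).

Definition comp_iso X Y Z (g : nform Y Z) (f : nform X Y) W (w : hom1 W X) :
    liniso ((g \c f) \c w) (act g (act f w)) :=
  liniso_comp (nf_iso g (act f w))
    (liniso_comp (lwhisk g (nf_iso f w)) (assoc g f w)).

Lemma comp_nat X Y Z (g : nform Y Z) (f : nform X Y) W (w w' : hom1 W X)
    (v : w ~> w') :
  fwd (comp_iso g f w') \v (lid (g \c f) \h v) =
  actm g (actm f v) \v fwd (comp_iso g f w).
Proof.
rewrite /= -!lcompA -whisk1 assoc_nat (lcompA (_ \h _)) -whiskl nf_nat.
by rewrite whiskl -lcompA (lcomp_eql (nf_nat _ _)) -!lcompA.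
Qed.

Canonical nf_comp X Y Z (g : nform Y Z) (f : nform X Y) : nform X Z :=
  @NForm X Z (g \c f) (fun W w => act g (act f w)) (comp_iso g f)
    (fun W w w' v => actm g (actm f v)) (@comp_nat X Y Z g f).

End NormalForms.

(** Locked so that a rewriting step with associativity or with [hat_comp] treats
    [hat u w] and [u] as single cells. *)
HB.lock Definition hat (k : comPzRingType) (C : bicat k) (X Y : C)
    (f g : nform X Y) (u : f ~> g) (W : C) (w : hom1 W X) : act f w ~> act g w :=
  fwd (nf_iso g w) \v (u \h lid w) \v bwd (nf_iso f w).
Arguments hat {k C X Y f g} u {W} w.

Section Hats.
Context {k : comPzRingType} {C : bicat k}.
Implicit Types X Y Z T W : C.

Lemma actmE X Y (f : nform X Y) W (w w' : hom1 W X) (v : w ~> w') :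
  actm f v = fwd (nf_iso f w') \v (lid f \h v) \v bwd (nf_iso f w).
Proof. by rewrite lcompA nf_nat -lcompA bwdK lcompf1. Qed.

Lemma actm1 X Y (f : nform X Y) W (w : hom1 W X) :
  actm f (lid w) = lid (act f w).
Proof. by rewrite actmE whisk1 lcomp1f bwdK. Qed.

Lemma hat_id X Y (f : nform X Y) W (w : hom1 W X) :
  hat (lid f) w = lid (act f w).
Proof. by rewrite hat.unlock whisk1 lcomp1f bwdK. Qed.

Lemma hat_comp X Y (f g h : nform X Y) (v : g ~> h) (u : f ~> g) W
    (w : hom1 W X) :
  hat (v \v u) w = hat v w \v hat u w.
Proof. by rewrite hat.unlock whiskr -!lcompA fwdKl. Qed.

(** The interchange law, in the form in which it is used from here on. *)
Lemma hat_nat X Y (f g : nform X Y) (u : f ~> g) W (w w' : hom1 W X)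
    (v : w ~> w') :
  hat u w' \v actm f v = actm g v \v hat u w.
Proof.
by rewrite !actmE hat.unlock -!lcompA !fwdKl (lcomp_eql (exchange _ _)) -lcompA.
Qed.

Lemma hat_h X Y Z (g g' : nform Y Z) (f f' : nform X Y) (v : g ~> g')
    (u : f ~> f') W (w : hom1 W X) :
  hat (f := nf_comp g f) (g := nf_comp g' f') (v \h u) w =
  hat v (act f' w) \v actm g (hat u w).
Proof.
rewrite hat.unlock actmE /= -!lcompA fwdKl; congr (_ \v _).
rewrite [in RHS](lcompA (v \h _)) -!bimapM lcomp1f !lcompf1.
rewrite (lcomp_eql (assoc_nat _ _ _)) -lcompA (lcompA (lid _ \h _)) -bimapM.
rewrite lcomp1f (lcompA (fwd (assoc _ _ _))) bwdK lcomp1f.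
by rewrite lcompA -bimapM lcompf1 -!lcompA.
Qed.

(** Both bracketings of a threefold composite have the same action; that the
    associator is the identity between the two is the pentagon axiom. *)
Lemma hat_assoc X Y Z T (h : nform Z T) (g : nform Y Z) (f : nform X Y) W
    (w : hom1 W X) :
  hat (f := nf_comp (nf_comp h g) f) (g := nf_comp h (nf_comp g f))
    (fwd (assoc h g f)) w = lid (act h (act g (act f w))).
Proof.
rewrite hat.unlock lcompA.
have <- : fwd (nf_iso (nf_comp (nf_comp h g) f) w) =
    fwd (nf_iso (nf_comp h (nf_comp g f)) w) \v (fwd (assoc h g f) \h lid w).
  rewrite /= -!lcompA -whisk1 (lcomp_eql (assoc_nat _ _ _)) -!lcompA.
  by rewrite pentagon !whiskl -!lcompA.
exact (bwdK (nf_iso (nf_comp (nf_comp h g) f) w)).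
Qed.

Lemma hat_bwd X Y (f g : nform X Y) (i : liniso f g) W (w : hom1 W X)
    (j : liniso (act f w) (act g w)) :
  hat (fwd i) w = fwd j -> hat (bwd i) w = bwd j.
Proof.
move=> E; apply: (fwd_monic (i := j)).
by rewrite bwdK -E -hat_comp bwdK hat_id.
Qed.

Lemma hat_assoc_bwd X Y Z T (h : nform Z T) (g : nform Y Z) (f : nform X Y) W
    (w : hom1 W X) :
  hat (g := nf_comp (nf_comp h g) f) (f := nf_comp h (nf_comp g f))
    (bwd (assoc h g f)) w = lid (act h (act g (act f w))).
Proof.
exact: (@hat_bwd _ _ (nf_comp (nf_comp h g) f) (nf_comp h (nf_comp g f))
   (assoc h g f) _ _ (liniso1 _) (hat_assoc _ _ _ _)).
Qed.

Lemma hat_lunit X Y (f : nform X Y) W (w : hom1 W X) :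
  hat (f := nf_comp (nf_one Y) f) (g := f) (fwd (lunit f)) w = lid (act f w).
Proof.
rewrite hat.unlock lcompA.
have <- : fwd (nf_iso (nf_comp (nf_one Y) f) w) =
    fwd (nf_iso f w) \v (fwd (lunit f) \h lid w).
  by rewrite /= lcompA lunit_nat -lcompA lunit_comp.
exact: bwdK.
Qed.

Lemma hat_lunit_bwd X Y (f : nform X Y) W (w : hom1 W X) :
  hat (g := nf_comp (nf_one Y) f) (f := f) (bwd (lunit f)) w = lid (act f w).
Proof.
exact: (@hat_bwd _ _ (nf_comp (nf_one Y) f) f
   (lunit f) _ _ (liniso1 _) (hat_lunit _ _)).
Qed.

Lemma hat_runit X Y (f : nform X Y) W (w : hom1 W X) :
  hat (f := nf_comp f (nf_one X)) (g := f) (fwd (runit f)) w = lid (act f w).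
Proof.
rewrite hat.unlock lcompA.
have <- : fwd (nf_iso (nf_comp f (nf_one X)) w) =
    fwd (nf_iso f w) \v (fwd (runit f) \h lid w).
  by rewrite /= triangle.
exact: bwdK.
Qed.

Lemma hat_runit_bwd X Y (f : nform X Y) W (w : hom1 W X) :
  hat (g := nf_comp f (nf_one X)) (f := f) (bwd (runit f)) w = lid (act f w).
Proof.
exact: (@hat_bwd _ _ (nf_comp f (nf_one X)) f
   (runit f) _ _ (liniso1 _) (hat_runit _ _)).
Qed.

(** Already the value at the identity 1-cell determines a 2-cell, since whiskering
    with an identity is faithful. *)
Lemma hat_inj X Y (f g : nform X Y) (u v : f ~> g) :
  (forall W (w : hom1 W X), hat u w = hat v w) -> u = v.
Proof.
move=> /(_ _ (id1 X)); rewrite hat.unlock => /fwd_monic E; apply: rwhisk_id_inj.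
exact: (fwd_epic (i := liniso_inv (nf_iso f _)) E).
Qed.

Lemma hat_linear X Y (f g : nform X Y) W (w : hom1 W X) :
  linear (fun u : f ~> g => hat u w).
Proof.
move=> a u v.
by rewrite hat.unlock (bimap_linearl _ _ a u v) (lcomp_linearl _ a) (lcomp_linearr _ a).
Qed.

Definition hatE := (hat_comp, hat_assoc, hat_assoc_bwd, hat_lunit,
  hat_lunit_bwd, hat_runit, hat_runit_bwd, hat_h, hat_id, actm1).

End Hats.

Ltac hat_simpl := rewrite ?hatE /= ?lcomp1f ?lcompf1.

(** * Direct sums of 1-cells *)
Section LinearCategories.
Context {k : comPzRingType}.

Lemma sum_linear (U V : lmodType k) (h : U -> V) I (r : seq I) (P : pred I)
    (u : I -> U) :
  linear h -> h (\sum_(i <- r | P i) u i) = \sum_(i <- r | P i) h (u i).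
Proof.
move=> hL; have hD x y : h (x + y) = h x + h y.
  by have := hL 1 x y; rewrite !scale1r.
by apply: (big_morph h hD); apply: (addrI (h 0)); rewrite -hD !addr0.
Qed.

Section Sums.
Context {C : lincat k}.

Lemma lcomp_suml (a b c : C) n (g : 'I_n -> (b ~> c)) (f : a ~> b) :
  (\sum_i g i) \v f = \sum_i (g i \v f).
Proof. exact: (sum_linear _ _ _ (lcomp_linearl f)). Qed.

Lemma lcomp_sumr (a b c : C) n (g : b ~> c) (f : 'I_n -> (a ~> b)) :
  g \v (\sum_i f i) = \sum_i (g \v f i).
Proof. exact: (sum_linear _ _ _ (lcomp_linearr g)). Qed.

(** The structure whose existence [dirsum] asserts, so that the injections and
    projections can be used to define 2-cells. *)
Record dirsum_data n (a : 'I_n -> C) (s : C) := DirsumData {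
  dinj : forall i, a i ~> s;
  dproj : forall i, s ~> a i;
  dinjK : forall i, dproj i \v dinj i = lid (a i);
  dproj_inj0 : forall i j, i != j -> dproj i \v dinj j = 0;
  dsum_id : \sum_(i < n) (dinj i \v dproj i) = lid s
}.

Lemma dirsumP n (a : 'I_n -> C) (s : C) :
  dirsum a s <-> inhabited (dirsum_data a s).
Proof.
split=> [[j [p [K K0 K1]]]|[[j p K K0 K1]]]; first by do 2 econstructor; eauto.
by exists j, p.
Qed.

Definition dirsum_choice (addC : additive_cat C) n (a : 'I_n -> C) :
    {s : C & dirsum_data a s}.
Proof.
have /cid [s /dirsumP sP] := addC n a; exists s.
by have /inhabited_witness := sP.
Qed.

Section Universal.
Context {n : nat} {a : 'I_n -> C} {s : C} (d : dirsum_data a s).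

Lemma dproj_monic b (u v : b ~> s) :
  (forall i, dproj d i \v u = dproj d i \v v) -> u = v.
Proof.
move=> E; rewrite -(lcomp1f u) -(lcomp1f v) -(dsum_id d) !lcomp_suml.
by apply: eq_bigr => i _; rewrite -!lcompA E.
Qed.

Lemma dinj_epic b (u v : s ~> b) :
  (forall i, u \v dinj d i = v \v dinj d i) -> u = v.
Proof.
move=> E; rewrite -(lcompf1 u) -(lcompf1 v) -(dsum_id d) !lcomp_sumr.
by apply: eq_bigr => i _; rewrite !lcompA E.
Qed.

Lemma dproj_sum b (u : forall i, b ~> a i) i :
  dproj d i \v (\sum_j (dinj d j \v u j)) = u i.
Proof.
rewrite lcomp_sumr (bigD1 i) //= lcompA dinjK lcomp1f big1 ?addr0 // => j nij.
by rewrite lcompA dproj_inj0 1?eq_sym // lcomp0l.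
Qed.

Lemma sum_dinj b (u : forall i, a i ~> b) i :
  (\sum_j (u j \v dproj d j)) \v dinj d i = u i.
Proof.
rewrite lcomp_suml (bigD1 i) //= -lcompA dinjK lcompf1 big1 ?addr0 // => j nij.
by rewrite -lcompA dproj_inj0 // lcomp0r.
Qed.

End Universal.
Arguments dproj_monic {n a s} d [b u v].
Arguments dinj_epic {n a s} d [b u v].

Section Maps.
Context {n : nat} {a a' : 'I_n -> C} {s s' : C}.
Context (d : dirsum_data a s) (d' : dirsum_data a' s').

Definition dsum_map (u : forall i, a i ~> a' i) : s ~> s' :=
  \sum_i (dinj d' i \v u i \v dproj d i).

Lemma dproj_map (u : forall i, a i ~> a' i) i :
  dproj d' i \v dsum_map u = u i \v dproj d i.
Proof. exact: (dproj_sum d' (fun i => u i \v dproj d i)). Qed.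

Lemma map_dinj (u : forall i, a i ~> a' i) i :
  dsum_map u \v dinj d i = dinj d' i \v u i.
Proof.
rewrite -(sum_dinj d (fun i => dinj d' i \v u i)).
by congr (_ \v _); apply: eq_bigr => j _; rewrite lcompA.
Qed.

End Maps.

Lemma dsum_mapK n (a a' : 'I_n -> C) s s' (d : dirsum_data a s)
    (d' : dirsum_data a' s') (u : forall i, a i ~> a' i)
    (v : forall i, a' i ~> a i) :
  (forall i, v i \v u i = lid (a i)) ->
  dsum_map d' d v \v dsum_map d d' u = lid s.
Proof.
move=> K; apply: (dproj_monic d) => i.
by rewrite lcompA dproj_map -lcompA dproj_map lcompA K lcomp1f lcompf1.
Qed.

End Sums.
End LinearCategories.
Arguments dproj_monic {k C n a s} d [b u v].
Arguments dinj_epic {k C n a s} d [b u v].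

(** Locked: only its compatibility with projections and injections is used, and
    as a single cell it is stable under rewriting with associativity. *)
HB.lock Definition dsum_iso (k : comPzRingType) (C : lincat k) n
    (a a' : 'I_n -> C) s s' (d : dirsum_data a s) (d' : dirsum_data a' s')
    (u : forall i, liniso (a i) (a' i)) : liniso s s' :=
  @LinIso _ _ _ _ (dsum_map d d' (fun i => fwd (u i)))
    (dsum_map d' d (fun i => bwd (u i)))
    (dsum_mapK d d' (fun i => fwdK (u i)))
    (dsum_mapK d' d (fun i => bwdK (u i))).
Arguments dsum_iso {k C n a a' s s'} d d' u.

Section SumIsos.
Context {k : comPzRingType} {C : lincat k} {n : nat} {a a' : 'I_n -> C} {s s' : C}.
Context (d : dirsum_data a s) (d' : dirsum_data a' s').
Context (u : forall i, liniso (a i) (a' i)).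

Lemma dproj_iso i :
  dproj d' i \v fwd (dsum_iso d d' u) = fwd (u i) \v dproj d i.
Proof. by rewrite dsum_iso.unlock dproj_map. Qed.

Lemma iso_dinj i :
  fwd (dsum_iso d d' u) \v dinj d i = dinj d' i \v fwd (u i).
Proof. by rewrite dsum_iso.unlock map_dinj. Qed.

Definition dirsum_transport : dirsum_data a' s.
Proof.
refine (@DirsumData _ _ _ _ _ (fun i => dinj d i \v bwd (u i))
  (fun i => fwd (u i) \v dproj d i) _ _ _).
- abstract (by move=> i; rewrite -lcompA (lcompA (dproj d i)) dinjK lcomp1f bwdK).
- abstract (by move=> i j nij;
    rewrite -lcompA (lcompA (dproj d i)) dproj_inj0 // lcomp0l lcomp0r).
- abstract (by under eq_bigr do rewrite -lcompA fwdKl; apply: dsum_id).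
Defined.

End SumIsos.

Section WhiskeredSums.
Context {k : comPzRingType}.

Lemma bimap_suml (C D E : lincat k) (H : bifunctor C D E) (a a' : C) (b b' : D)
    n (u : 'I_n -> (a ~> a')) (v : b ~> b') :
  bimap H (\sum_i u i) v = \sum_i bimap H (u i) v.
Proof. exact: (sum_linear _ _ _ (bimap_linearl H v)). Qed.

Lemma bimap_sumr (C D E : lincat k) (H : bifunctor C D E) (a a' : C) (b b' : D)
    n (u : a ~> a') (v : 'I_n -> (b ~> b')) :
  bimap H u (\sum_i v i) = \sum_i bimap H u (v i).
Proof. exact: (sum_linear _ _ _ (bimap_linearr H u)). Qed.

Context {C : bicat k}.
Implicit Types X Y Z : C.

Definition lwhisk_dirsum X Y Z (g : hom1 Y Z) n (a : 'I_n -> hom1 X Y) s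
    (d : dirsum_data a s) : dirsum_data (fun i => g \c a i) (g \c s).
Proof.
refine (@DirsumData _ _ _ _ _ (fun i => lid g \h dinj d i)
  (fun i => lid g \h dproj d i) _ _ _).
- abstract (by move=> i; rewrite -whiskl dinjK whisk1).
- abstract (by move=> i j nij; rewrite -whiskl dproj_inj0 // bimap0r).
- abstract (by under eq_bigr do rewrite -whiskl;
    rewrite -bimap_sumr dsum_id whisk1).
Defined.

Definition rwhisk_dirsum X Y Z (f : hom1 X Y) n (a : 'I_n -> hom1 Y Z) s
    (d : dirsum_data a s) : dirsum_data (fun i => a i \c f) (s \c f).
Proof.
refine (@DirsumData _ _ _ _ _ (fun i => dinj d i \h lid f)
  (fun i => dproj d i \h lid f) _ _ _).
- abstract (by move=> i; rewrite -whiskr dinjK whisk1).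
- abstract (by move=> i j nij; rewrite -whiskr dproj_inj0 // bimap0l).
- abstract (by under eq_bigr do rewrite -whiskr;
    rewrite -bimap_suml dsum_id whisk1).
Defined.

End WhiskeredSums.

(** * Direct sums of pseudonatural transformations *)
Section SumOfTransformations.
Context {k : comPzRingType} {B C : bicat k} {F G : pseudofunctor B C}.
Context {n : nat} (s : 'I_n -> pseudonat F G).
Context (t : forall X : B, hom1 (F X) (G X)).
Context (d : forall X : B, dirsum_data (fun i => s i X) (t X)).

Definition psum_cell X Y (f : hom1 X Y) :
    liniso (pfhom G f \c t X) (t Y \c pfhom F f) :=
  dsum_iso (lwhisk_dirsum (pfhom G f) (d X)) (rwhisk_dirsum (pfhom F f) (d Y))
    (fun i => pncell (s i) f).

(** The square that makes the projections modifications.  As they are jointly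
    monic, it reduces each axiom for the sum to the same axiom for the summands. *)
Lemma dproj_psum_cell X Y (f : hom1 X Y) i :
  (dproj (d Y) i \h lid (pfhom F f)) \v fwd (psum_cell f) =
  fwd (pncell (s i) f) \v (lid (pfhom G f) \h dproj (d X) i).
Proof.
exact: (dproj_iso (lwhisk_dirsum (pfhom G f) (d X))
  (rwhisk_dirsum (pfhom F f) (d Y))).
Qed.

Lemma psum_cell_dinj X Y (f : hom1 X Y) i :
  fwd (psum_cell f) \v (lid (pfhom G f) \h dinj (d X) i) =
  (dinj (d Y) i \h lid (pfhom F f)) \v fwd (pncell (s i) f).
Proof.
exact: (iso_dinj (lwhisk_dirsum (pfhom G f) (d X))
  (rwhisk_dirsum (pfhom F f) (d Y))).
Qed.

Lemma psum_monic X Y (f : hom1 X Y) (x : hom1 (F X) (G Y))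
    (u v : x ~> t Y \c pfhom F f) :
  (forall i, (dproj (d Y) i \h lid _) \v u = (dproj (d Y) i \h lid _) \v v) ->
  u = v.
Proof.
move=> E; have := @dproj_monic _ _ _ _ _ (rwhisk_dirsum (pfhom F f) (d Y)) _ u v.
by apply=> i; exact: E.
Qed.

Lemma psum_nat (X Y : B) (f f' : hom1 X Y) (u : f ~> f') :
  fwd (psum_cell f') \v (fmap (pfhom G) u \h lid (t X)) =
  (lid (t Y) \h fmap (pfhom F) u) \v fwd (psum_cell f).
Proof.
apply: psum_monic => i.
rewrite (lcomp_eql (dproj_psum_cell _ _)) (lcomp_eql (exchange _ _)).
rewrite -!lcompA dproj_psum_cell -exchange !lcompA; congr (_ \v _).
exact: pn_nat.
Qed.

Lemma psum_unit (X : B) :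
  fwd (psum_cell (id1 X)) \v (fwd (pfunit G X) \h lid (t X)) =
  (lid (t X) \h fwd (pfunit F X)) \v bwd (runit (t X)) \v fwd (lunit (t X)).
Proof.
apply: psum_monic => i.
rewrite (lcomp_eql (dproj_psum_cell _ _)) (lcomp_eql (exchange _ _)).
rewrite -!lcompA -exchange lcompA pn_unit -!lcompA; congr (_ \v _).
by rewrite lunit_nat !lcompA runit_nat_bwd.
Qed.

Lemma psum_comp (X Y Z : B) (g : hom1 Y Z) (f : hom1 X Y) :
  fwd (psum_cell (g \c f)) \v (fwd (pfcomp G g f) \h lid (t X)) =
  (lid (t Z) \h fwd (pfcomp F g f))
    \v fwd (assoc (t Z) (pfhom F g) (pfhom F f))
    \v (fwd (psum_cell g) \h lid (pfhom F f))
    \v bwd (assoc (pfhom G g) (t Y) (pfhom F f))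
    \v (lid (pfhom G g) \h fwd (psum_cell f))
    \v fwd (assoc (pfhom G g) (pfhom G f) (t X)).
Proof.
apply: psum_monic => i; apply: hat_inj => W w.
have D Y' Z' (h : hom1 Y' Z') W' (w' : hom1 W' (F Y')) :=
  congr1 (fun u => hat u w') (dproj_psum_cell h i).
have := congr1 (fun u => hat u w) (pn_comp (s i) g f).
move: (D _ _ (g \c f) W w) (D _ _ g W) (D _ _ f W w).
hat_simpl => {}D Dg Df E.
rewrite (lcomp_eql D) -lcompA -(hat_nat (fwd (pfcomp G g f))) /=.
rewrite (lcomp_eql E) -!lcompA.
rewrite (lcomp_eql (hat_nat (dproj (d Z) i) _)) -lcompA /=.
congr (_ \v _).
have := Dg (pfhom F f \c w).
hat_simpl => {}Dg.
rewrite (lcomp_eql Dg) -!lcompA -!whiskl.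
by rewrite Df.
Qed.

Definition psum : pseudonat F G := PseudoNat psum_nat psum_unit psum_comp.

Lemma psum_dinjP i :
  @is_modification _ _ _ _ _ (s i) psum (fun X => dinj (d X) i).
Proof. by move=> X Y f; apply: psum_cell_dinj. Qed.

Lemma psum_dprojP i :
  @is_modification _ _ _ _ _ psum (s i) (fun X => dproj (d X) i).
Proof. by move=> X Y f; rewrite dproj_psum_cell. Qed.

End SumOfTransformations.

Lemma mod_sumE (k : comPzRingType) (B C : bicat k) (F G : pseudofunctor B C)
    (s t : pseudonat F G) n (m : 'I_n -> modification s t) (X : B) :
  (\sum_i m i) X = \sum_i m i X.
Proof. exact: (big_morph (fun m : modification s t => m X)). Qed.

Lemma psfun_locally_additive (k : comPzRingType) (B C : bicat k) :
  locally_additive C -> locally_additive (PsFun B C).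
Proof.
move=> addC F G n s.
pose d X := projT2 (dirsum_choice (addC (F X) (G X)) (fun i => s i X)).
exists (psum d); exists (fun i => Modification (psum_dinjP d i)).
exists (fun i => Modification (psum_dprojP d i)); split=> [i|i j nij|].
- by apply: modification_eq => X; apply: dinjK.
- by apply: modification_eq => X; apply: dproj_inj0.
- apply: modification_eq => X; rewrite mod_sumE; exact: dsum_id.
Qed.

(** * Objects that are sums of images of idempotents *)
Section HatSums.
Context {k : comPzRingType} {C : bicat k}.

Lemma hat0 (X Y : C) (f g : nform X Y) W (w : hom1 W X) :
  hat (0 : f ~> g) w = 0.
Proof.
by have := hat_linear w (-1) (0 : f ~> g) 0; rewrite scaler0 addr0 scaleN1r addNr.
Qed.

Lemma hat_sum (X Y : C) (f g : nform X Y) n (u : 'I_n -> (f ~> g)) W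
    (w : hom1 W X) :
  hat (\sum_i u i) w = \sum_i hat (u i) w.
Proof. exact: (sum_linear _ _ _ (hat_linear w)). Qed.

Lemma lcomp_through0 (D : lincat k) (x y z : D) (g : y ~> z) (f : x ~> y) :
  lid y = 0 -> g \v f = 0.
Proof. by move=> E; rewrite -(lcompf1 g) E lcomp0r lcomp0l. Qed.

End HatSums.

Section Blocks.
Context {k : comPzRingType} {C : bicat k}.

(** [N] is the direct sum of the images of the idempotents [e i].  For [e i = 1]
    this is a direct sum of the objects [O i]; for [n = 1] it is a splitting of
    the idempotent [e ord0].  The 2-cells [eta i] and [eta' i] present [id1 N] as
    the sum of the [bin i \c bout i], while [eps i] and [eps' i] present
    [bout i \c bin i] as the image of [e i].  That [bout i \c bin j] is a zero
    object is said by the vanishing of its identity. *)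
Record blocks n (O : 'I_n -> C) (e : forall i, id1 (O i) ~> id1 (O i)) (N : C) :=
  Blocks {
  bin : forall i, hom1 (O i) N;
  bout : forall i, hom1 N (O i);
  eta : forall i, id1 N ~> bin i \c bout i;
  eta' : forall i, bin i \c bout i ~> id1 N;
  eps : forall i, bout i \c bin i ~> id1 (O i);
  eps' : forall i, id1 (O i) ~> bout i \c bin i;
  eta_retr : forall i, eta i \v eta' i = lid (bin i \c bout i);
  eta_sum : \sum_(i < n) (eta' i \v eta i) = lid (id1 N);
  eps_sect : forall i, eps' i \v eps i = lid (bout i \c bin i);
  eps_idem : forall i, eps i \v eps' i = e i;
  bout_bin0 : forall i j, i != j -> lid (bout i \c bin j) = 0
}.

Section Laws.
Context {n : nat} {O : 'I_n -> C} {e : forall i, id1 (O i) ~> id1 (O i)} {N : C}.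
Context (d : blocks e N).
Local Notation a := (bin d).
Local Notation b := (bout d).

Lemma eta_retr_hat i W (w : hom1 W N) :
  hat (eta d i) w \v hat (eta' d i) w = lid (a i \c b i \c w).
Proof. by have := congr1 (fun u => hat u w) (eta_retr d i); hat_simpl. Qed.

Lemma eta_sum_hat W (w : hom1 W N) :
  \sum_i (hat (eta' d i) w \v hat (eta d i) w) = lid w.
Proof.
have := congr1 (fun u => hat u w) (eta_sum d); rewrite hat_sum; hat_simpl.
by move=> <-; apply: eq_bigr => i _; rewrite hatE.
Qed.

Lemma eps_sect_hat i W (w : hom1 W (O i)) :
  hat (eps' d i) w \v hat (eps d i) w = lid (b i \c a i \c w).
Proof. by have := congr1 (fun u => hat u w) (eps_sect d i); hat_simpl. Qed.

Lemma eps_idem_hat i W (w : hom1 W (O i)) :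
  hat (eps d i) w \v hat (eps' d i) w = hat (e i) w.
Proof. by have := congr1 (fun u => hat u w) (eps_idem d i); hat_simpl. Qed.

Lemma bout_bin0_hat i j (nij : i != j) W (w : hom1 W (O j)) :
  lid (b i \c a j \c w) = 0.
Proof.
by have := congr1 (fun u => hat u w) (bout_bin0 d nij); hat_simpl; rewrite hat0.
Qed.

Lemma idem_eps i : e i \v eps d i = eps d i.
Proof.
transitivity ((eps d i \v eps' d i) \v eps d i); first by rewrite eps_idem.
by rewrite -lcompA eps_sect lcompf1.
Qed.

Lemma eps'_idem i : eps' d i \v e i = eps' d i.
Proof.
transitivity (eps' d i \v (eps d i \v eps' d i)); first by rewrite eps_idem.
by rewrite lcompA eps_sect lcomp1f.
Qed.

Lemma idem_eps_hat i W (w : hom1 W (O i)) :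
  hat (e i) w \v hat (eps d i) w = hat (eps d i) w.
Proof. by rewrite -eps_idem_hat -lcompA eps_sect_hat lcompf1. Qed.

(** Among the summands of the identity of [N], only the [i]-th one survives
    composition with [bin i], as [bout j \c bin i = 0] for [j != i]. *)
Lemma eta_sect_bin i W (w : hom1 W (O i)) :
  hat (eta' d i) (a i \c w) \v hat (eta d i) (a i \c w) = lid (a i \c w).
Proof.
rewrite -(eta_sum_hat (a i \c w)) (bigD1 i) //= big1 ?addr0 // => j nji.
by apply: lcomp_through0; rewrite -whisk1 bout_bin0_hat // bimap0r.
Qed.

Lemma eta_sect_bout i W (w : hom1 W N) :
  (lid (b i) \h hat (eta' d i) w) \v (lid (b i) \h hat (eta d i) w) =
  lid (b i \c w).
Proof.
rewrite -whisk1 -(eta_sum_hat w) bimap_sumr (bigD1 i) //= big1 ?addr0 => [|j nji].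
  by rewrite whiskl.
by rewrite whiskl; apply: lcomp_through0; rewrite bout_bin0_hat // eq_sym.
Qed.

(** On the image of [e i] this idempotent is the identity.  This and
    the next two lemmas say it for [bout i \c bin i], for [bout i] and for
    [bin i]. *)
Lemma idem_bout_bin i W (w : hom1 W (O i)) :
  hat (e i) (b i \c a i \c w) = lid (b i \c a i \c w).
Proof.
rewrite -[LHS]lcomp1f -eps_sect_hat.
have /= E := hat_nat (e i) (hat (eps d i) w).
by rewrite -lcompA -E idem_eps_hat.
Qed.

Lemma idem_bout i W (w : hom1 W N) : hat (e i) (b i \c w) = lid (b i \c w).
Proof.
rewrite -[LHS]lcomp1f -eta_sect_bout -lcompA.
have /= <- := hat_nat (e i) (lid (b i) \h hat (eta d i) w).
by rewrite idem_bout_bin lcomp1f eta_sect_bout.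
Qed.

Lemma bin_idem i W (w : hom1 W (O i)) : lid (a i) \h hat (e i) w = lid (a i \c w).
Proof.
rewrite -[LHS]lcomp1f -eta_sect_bin -lcompA.
have /= -> := hat_nat (eta d i) (lid (a i) \h hat (e i) w).
have /= E : lid (b i) \h (lid (a i) \h hat (e i) w) = lid (b i \c a i \c w).
  rewrite -[LHS]lcomp1f -(eps_sect_hat w) -lcompA.
  have /= -> := hat_nat (eps d i) (hat (e i) w).
  by rewrite idem_eps_hat.
by rewrite E whisk1 lcomp1f.
Qed.

(** These identities make [bout i] a left adjoint of [bin i]; for arbitrary
    blocks they may fail, as for an equivalence that is not an adjoint one. *)
Definition triangles (d : blocks e N) : Prop :=
  (forall i W (w : hom1 W (O i)),
     (lid (bin d i) \h hat (eps d i) w) \v hat (eta d i) (bin d i \c w) =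
     lid (bin d i \c w)) /\
  (forall i W (w : hom1 W N),
     hat (eps d i) (bout d i \c w) \v (lid (bout d i) \h hat (eta d i) w) =
     lid (bout d i \c w)).

(** The classical correction of the counit of an equivalence into that of an
    adjoint equivalence: insert [bout i \c bin i] by [eps'], cancel the middle
    composite [bin i \c bout i] by [eta'], and apply [eps]. *)
Definition adj_eps i : b i \c a i ~> id1 (O i) :=
  eps d i
   \v (lid (b i) \h (fwd (lunit (a i)) \v (eta' d i \h lid (a i))
                       \v bwd (assoc (a i) (b i) (a i))))
   \v fwd (assoc (b i) (a i) (b i \c a i))
   \v (eps' d i \h lid (b i \c a i))
   \v bwd (lunit (b i \c a i)).

Lemma adj_eps_hat i W (w : hom1 W (O i)) :
  hat (adj_eps i) w = hat (eps d i) w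
    \v (lid (b i) \h hat (eta' d i) (a i \c w))
    \v hat (eps' d i) (b i \c a i \c w).
Proof. by rewrite /adj_eps; hat_simpl. Qed.

Definition adj_eps' i : id1 (O i) ~> b i \c a i :=
  fwd (lunit (b i \c a i))
   \v (eps d i \h lid (b i \c a i))
   \v bwd (assoc (b i) (a i) (b i \c a i))
   \v (lid (b i) \h (fwd (assoc (a i) (b i) (a i)) \v (eta d i \h lid (a i))
                       \v bwd (lunit (a i))))
   \v eps' d i.

Lemma adj_eps'_hat i W (w : hom1 W (O i)) :
  hat (adj_eps' i) w = hat (eps d i) (b i \c a i \c w)
    \v (lid (b i) \h hat (eta d i) (a i \c w))
    \v hat (eps' d i) w.
Proof. by rewrite /adj_eps'; hat_simpl. Qed.

Lemma adj_eps_sect i : adj_eps' i \v adj_eps i = lid (b i \c a i).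
Proof.
apply: hat_inj => W w; rewrite hatE adj_eps_hat adj_eps'_hat hat_id.
rewrite -!lcompA (lcompA (hat (eps' d i) w)) eps_sect_hat lcomp1f.
rewrite (lcompA (lid _ \h _)) -whiskl eta_retr_hat whisk1 lcomp1f.
by rewrite eps_idem_hat idem_bout.
Qed.

Lemma adj_eps_idem i : adj_eps i \v adj_eps' i = e i.
Proof.
apply: hat_inj => W w; rewrite hatE adj_eps_hat adj_eps'_hat.
rewrite -!lcompA (lcompA (hat (eps' d i) _)) eps_sect_hat lcomp1f.
by rewrite (lcompA (lid _ \h _)) -whiskl eta_sect_bin whisk1 lcomp1f eps_idem_hat.
Qed.

Definition adj_blocks : blocks e N :=
  Blocks (eta_retr d) (eta_sum d) adj_eps_sect adj_eps_idem (@bout_bin0 _ _ _ _ d).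

(** The two ways of contracting a fourfold composite agree: they do after [eps],
    by interchange, and [eps] is monic.  The next three lemmas are the analogues
    for the other 2-cells; the triangle identities of [adj_blocks] rest on
    them. *)
Lemma eps_bout_bin i W (w : hom1 W (O i)) :
  hat (eps d i) (b i \c a i \c w) = lid (b i) \h (lid (a i) \h hat (eps d i) w).
Proof.
have /= E := hat_nat (eps d i) (hat (eps d i) w).
rewrite -[LHS]lcomp1f -[RHS]lcomp1f -(eps_sect_hat w) -!lcompA.
by rewrite E.
Qed.

Lemma eps'_bout_bin i W (w : hom1 W (O i)) :
  hat (eps' d i) (b i \c a i \c w) = lid (b i) \h (lid (a i) \h hat (eps' d i) w).
Proof.
rewrite -[LHS]lcompf1 -[RHS]lcomp1f -(eps_sect_hat (b i \c a i \c w)).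
rewrite eps_bout_bin -lcompA -whiskl -whiskl eps_idem_hat bin_idem.
by rewrite !whisk1.
Qed.

Lemma eta'_bin_bout i W (w : hom1 W N) :
  hat (eta' d i) (a i \c b i \c w) = lid (a i) \h (lid (b i) \h hat (eta' d i) w).
Proof.
have /= E := hat_nat (eta' d i) (hat (eta' d i) w).
rewrite -[LHS]lcomp1f -[RHS]lcomp1f -(eta_retr_hat i w) -!lcompA.
by rewrite E.
Qed.

Lemma eta_bin_bout i W (w : hom1 W N) :
  hat (eta d i) (a i \c b i \c w) = lid (a i) \h (lid (b i) \h hat (eta d i) w).
Proof.
have /= E := hat_nat (eta d i) (hat (eta d i) w).
rewrite -[LHS]lcompf1 -[RHS]lcompf1 -(eta_retr_hat i w) !lcompA.
by rewrite E.
Qed.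

Lemma adj_blocks_triangles : triangles adj_blocks.
Proof.
split=> i W w /=; rewrite adj_eps_hat.
  rewrite eps'_bout_bin !whiskl -!lcompA.
  have /= <- := hat_nat (eta d i) (lid (a i) \h hat (eps' d i) w).
  rewrite -eta'_bin_bout (lcompA (hat (eta' d i) _)) eta_sect_bin lcomp1f.
  by rewrite -whiskl eps_idem_hat bin_idem.
have /= E := hat_nat (eps' d i) (lid (b i) \h hat (eta d i) w).
rewrite -!lcompA E -eta_bin_bout (lcompA (lid _ \h _)) -whiskl eta_sect_bin.
by rewrite whisk1 lcomp1f eps_idem_hat idem_bout.
Qed.

End Laws.
End Blocks.

(** * Splitting idempotents in a Krull-Schmidt bicategory *)
Section SplittingIdempotents.
Context {k : comPzRingType} {C : bicat k}.
Implicit Types X Y Z N : C.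

(** A composite of sums is the sum of the diagonal composites, if the others are
    zero. *)
Section CompositeOfSums.
Context {X Y Z : C} {n : nat} {g_ : 'I_n -> hom1 Y Z} {g : hom1 Y Z}.
Context {f_ : 'I_n -> hom1 X Y} {f : hom1 X Y}.
Context (dg : dirsum_data g_ g) (df : dirsum_data f_ f).
Context (off : forall i j, i != j -> lid (g_ i \c f_ j) = 0).

Lemma comp_sum_id :
  \sum_i ((dinj dg i \h dinj df i) \v (dproj dg i \h dproj df i)) = lid (g \c f).
Proof.
rewrite -whisk1 -(dsum_id dg) -(dsum_id df) bimap_suml; apply: eq_bigr => i _.
rewrite bimap_sumr (bigD1 i) //= big1 ?addr0 -?bimapM // => j nji.
by rewrite bimapM; apply: lcomp_through0; apply: off; rewrite eq_sym.
Qed.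

Lemma comp_dinjK i :
  (dproj dg i \h dproj df i) \v (dinj dg i \h dinj df i) = lid (g_ i \c f_ i).
Proof. by rewrite -bimapM !dinjK whisk1. Qed.

Lemma comp_dproj_inj0 i j : i != j ->
  (dproj dg i \h dproj df i) \v (dinj dg j \h dinj df j) = 0.
Proof. by move=> nij; rewrite -bimapM !dproj_inj0 // bimap0l. Qed.

Definition comp_dirsum : dirsum_data (fun i => g_ i \c f_ i) (g \c f) :=
  DirsumData comp_dinjK comp_dproj_inj0 comp_sum_id.

End CompositeOfSums.

Lemma iso_lid0 (D : lincat k) (x y : D) : isomorphic x y -> lid y = 0 -> lid x = 0.
Proof.
by move=> [i] E; rewrite -(fwdK i) -(lcomp1f (fwd i)) E lcomp0l lcomp0r.
Qed.

Lemma zero_ob_lid (D : lincat k) (z : D) : zero_ob z <-> lid z = 0.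
Proof.
split=> [/(_ z) [[f [_ fP]] _]|E a]; first by rewrite -(fP (lid z)) // -(fP 0).
split; exists 0; split=> // f _; first by rewrite -(lcompf1 f) E lcomp0r.
by rewrite -(lcomp1f f) E lcomp0l.
Qed.

Lemma dirsum_blocks n (A : 'I_n -> C) S : object_dirsum A S ->
  inhabited (blocks (fun i => lid (id1 (A i))) S).
Proof.
move=> [I [P [PI PI0 [s /dirsumP [d] [u]]]]].
have {}PI i : liniso (P i \c I i) (id1 (A i)).
  exact: inhabited_witness (PI i).
constructor; refine (@Blocks _ _ _ _ _ _ I P (fun i => dproj d i \v bwd u)
  (fun i => fwd u \v dinj d i) (fun i => fwd (PI i)) (fun i => bwd (PI i))
  _ _ _ _ _) => [i||i|i|i j nij].
- by rewrite -lcompA fwdKl dinjK.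
- under eq_bigr do rewrite -lcompA (lcompA (dinj d _)).
  by rewrite -lcomp_sumr -lcomp_suml dsum_id lcomp1f bwdK.
- exact: fwdK.
- exact: bwdK.
- by have [z /zero_ob_lid z0 i0] := PI0 i j nij; apply: iso_lid0 i0 z0.
Qed.

(** The isomorphisms rearrange brackets and cancel the equivalence; the axioms
    hold for any isomorphisms of these types. *)
Section Transfer.
Context {n : nat} {A : 'I_n -> C} {e : forall i, id1 (A i) ~> id1 (A i)} {S X : C}.
Context (d : blocks e S) (f : hom1 X S) (g : hom1 S X).
Context (outer : forall i, liniso ((g \c bin d i) \c (bout d i \c f))
    (g \c ((bin d i \c bout d i) \c f))).
Context (unit_iso : liniso (g \c (id1 S \c f)) (id1 X)).
Context (inner : forall i j,
    liniso ((bout d i \c f) \c (g \c bin d j)) (bout d i \c bin d j)).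

Definition transfer_blocks : blocks e X.
Proof.
refine (@Blocks _ _ _ _ _ _ (fun i => g \c bin d i) (fun i => bout d i \c f)
  (fun i => bwd (outer i) \v (lid g \h (eta d i \h lid f)) \v bwd unit_iso)
  (fun i => fwd unit_iso \v (lid g \h (eta' d i \h lid f)) \v fwd (outer i))
  (fun i => eps d i \v fwd (inner i i))
  (fun i => bwd (inner i i) \v eps' d i) _ _ _ _ _).
- move=> i; rewrite -!lcompA fwdKl (lcompA (lid g \h _)) -whiskl -whiskr.
  by rewrite eta_retr !whisk1 lcomp1f fwdK.
- under eq_bigr => i _ do
    rewrite -!lcompA bwdKl (lcompA (lid g \h _)) -whiskl -whiskr.
  rewrite -lcomp_sumr -lcomp_suml -bimap_sumr -bimap_suml eta_sum.
  by rewrite !whisk1 lcomp1f bwdK.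
- by move=> i; rewrite -lcompA (lcompA (eps' d i)) eps_sect lcomp1f fwdK.
- by move=> i; rewrite -lcompA bwdKl eps_idem.
- move=> i j nij; rewrite -(fwdK (inner i j)).
  by apply: lcomp_through0; apply: bout_bin0.
Defined.

End Transfer.

Definition equiv_blocks n (A : 'I_n -> C) (e : forall i, id1 (A i) ~> id1 (A i))
    S X (d : blocks e S) (f : hom1 X S) (g : hom1 S X)
    (gf : liniso (g \c f) (id1 X)) (fg : liniso (f \c g) (id1 S)) : blocks e X :=
  transfer_blocks
    (fun i => liniso_comp (lwhisk g (liniso_inv (assoc _ _ _))) (assoc _ _ _))
    (liniso_comp gf (lwhisk g (lunit f)))
    (fun i j => liniso_comp (lwhisk (bout d i) (liniso_comp (lunit _)
      (liniso_comp (rwhisk (bin d j) fg) (liniso_inv (assoc _ _ _)))))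
      (assoc _ _ _)).

Section OrthogonalPieces.
Context {n : nat} {A : 'I_n -> C} {e : forall i, id1 (A i) ~> id1 (A i)} {X : C}.
Context (d : blocks e X).

Lemma eta_orthogonal i j : i != j -> eta d i \v eta' d j = 0.
Proof.
move=> nij; apply: hat_inj => W w; rewrite hatE hat0.
have /= -> := hat_nat (eta d i) (hat (eta' d j) w).
by rewrite lcomp_through0 // -whisk1 bout_bin0_hat // bimap0r.
Qed.

Definition blocks_sum : dirsum_data (fun i => bin d i \c bout d i) (id1 X) :=
  DirsumData (eta_retr d) eta_orthogonal (eta_sum d).

End OrthogonalPieces.

Lemma blocks_dirsum n (A : 'I_n -> C) S :
  blocks (fun i => lid (id1 (A i))) S -> object_dirsum A S.
Proof.
move=> d; exists (bin d), (bout d); split=> [i|i j nij|].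
- by constructor; exists (eps d i) (eps' d i); rewrite ?eps_sect ?eps_idem.
- exists (bout d i \c bin d j); last by constructor; apply: liniso1.
  by apply/zero_ob_lid/bout_bin0.
exists (id1 S); last by constructor; apply: liniso1.
by apply/dirsumP; constructor; apply: blocks_sum.
Qed.

Definition blocks_iso n (A : 'I_n -> C) X
    (d : blocks (fun i => lid (id1 (A i))) X) i :
    liniso (bout d i \c bin d i) (id1 (A i)) :=
  @LinIso _ _ _ _ (eps d i) (eps' d i) (eps_sect d i) (eps_idem d i).

Definition cancel_middle W X Y Z (a : hom1 Y Z) (b : hom1 X Y) (c : hom1 Y X)
    (f : hom1 W Y) (u : liniso (b \c c) (id1 Y)) :
    liniso ((a \c b) \c (c \c f)) (a \c f) :=
  liniso_comp (lwhisk a (liniso_comp (lunit f)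
    (liniso_comp (rwhisk f u) (liniso_inv (assoc b c f))))) (assoc a b (c \c f)).

Lemma middle0 W X Y Y' Z (a : hom1 Y Z) (b : hom1 X Y) (c : hom1 Y' X)
    (f : hom1 W Y') : lid (b \c c) = 0 -> lid ((a \c b) \c (c \c f)) = 0.
Proof.
move=> E; pose i := liniso_comp (lwhisk a (liniso_inv (assoc b c f)))
   (assoc a b (c \c f)).
by apply: (iso_lid0 (inhabits i)); rewrite -whisk1 -(whisk1 _ f) E bimap0l bimap0r.
Qed.

(** If [X] is the sum of the [A i] and [T] the sum of those with index in the
    image of [sigma], then [T] splits the projection of [X] onto these summands.
    The 1-cells between [X] and [T] are the sums of the composites through the
    common summands. *)
Section SubBlocks.
Context {n : nat} {A : 'I_n -> C} {X T : C}.
Context (d : blocks (fun i => lid (id1 (A i))) X).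
Context {m : nat} (sigma : 'I_m -> 'I_n) (sigma_inj : injective sigma).
Context {into : hom1 X T} {from : hom1 T X}.

Section Legs.
Context (T_iso : liniso (into \c from) (id1 T)).
Context (dX : dirsum_data (fun j => bin d (sigma j) \c bout d (sigma j))
                          (from \c into)).

Let X_eps : from \c into ~> id1 X :=
  \sum_j (eta' d (sigma j) \v dproj dX j).

Let X_eps' : id1 X ~> from \c into :=
  \sum_j (dinj dX j \v eta d (sigma j)).

Lemma X_eps_sect : X_eps' \v X_eps = lid (from \c into).
Proof.
apply: (dproj_monic dX) => i; apply: (dinj_epic dX) => j.
rewrite lcompA dproj_sum -!lcompA sum_dinj lcomp1f.
have [->|nij] := eqVneq i j; first by rewrite eta_retr dinjK.
by rewrite eta_orthogonal ?dproj_inj0 //; apply: contra_neq nij => /sigma_inj.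
Qed.

Lemma X_eps_idem :
  X_eps \v X_eps' = \sum_j (eta' d (sigma j) \v eta d (sigma j)).
Proof.
by rewrite lcomp_suml; apply: eq_bigr => j _; rewrite -lcompA dproj_sum.
Qed.

Definition legs_blocks : blocks (n := 1) (O := fun _ : 'I_1 => X) (fun _ =>
    \sum_j (eta' d (sigma j) \v eta d (sigma j))) T.
Proof.
refine (@Blocks _ _ _ (fun _ => X) _ _ (fun _ => into) (fun _ => from)
  (fun _ => bwd T_iso) (fun _ => fwd T_iso)
  (fun _ => X_eps) (fun _ => X_eps') _ _ _ _ _).
- by move=> _; apply: fwdK.
- by rewrite big_ord1 bwdK.
- by move=> _; apply: X_eps_sect.
- by move=> _; apply: X_eps_idem.
- by move=> i j; rewrite !ord1.
Defined.

End Legs.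

Context (t : blocks (fun i => lid (id1 (A (sigma i)))) T).
Context (dinto : dirsum_data (fun j => bin t j \c bout d (sigma j)) into).
Context (dfrom : dirsum_data (fun j => bin d (sigma j) \c bout t j) from).

Lemma into_from0 i j : i != j ->
  lid ((bin t i \c bout d (sigma i)) \c (bin d (sigma j) \c bout t j)) = 0.
Proof.
move=> nij; apply: middle0; apply: bout_bin0.
by apply: contra_neq nij => /sigma_inj.
Qed.

Lemma from_into0 i j : i != j ->
  lid ((bin d (sigma i) \c bout t i) \c (bin t j \c bout d (sigma j))) = 0.
Proof. by move=> nij; apply: middle0; apply: bout_bin0. Qed.

Definition sub_blocks : blocks (n := 1) (O := fun _ : 'I_1 => X) (fun _ =>
    \sum_j (eta' d (sigma j) \v eta d (sigma j))) T :=
  legs_blocks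
    (dsum_iso (comp_dirsum dinto dfrom into_from0) (blocks_sum t)
      (fun j => cancel_middle _ _ (blocks_iso d (sigma j))))
    (dirsum_transport (comp_dirsum dfrom dinto from_into0)
      (fun j => cancel_middle _ _ (blocks_iso t j))).

End SubBlocks.

(** Restriction along [bin i]: a multiplicative map from [End (Id_N)] to
    [End (Id_(O i))] that sends [1] to [e i]. *)
Section Compression.
Context {n : nat} {O : 'I_n -> C} {e : forall i, id1 (O i) ~> id1 (O i)} {N : C}.
Context (d : blocks e N) (i : 'I_n).
Local Notation a := (bin d i).
Local Notation b := (bout d i).

Definition compress (x : id1 N ~> id1 N) : id1 (O i) ~> id1 (O i) :=
  eps d i \v (lid b \h (fwd (lunit a) \v (x \h lid a) \v bwd (lunit a)))
    \v eps' d i.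

Lemma compress_hat x W (w : hom1 W (O i)) :
  hat (compress x) w =
  hat (eps d i) w \v (lid b \h hat x (a \c w)) \v hat (eps' d i) w.
Proof. by rewrite /compress; hat_simpl. Qed.

Lemma expand_hat x W (w : hom1 W (O i)) : lid b \h hat x (a \c w) =
  hat (eps' d i) w \v hat (compress x) w \v hat (eps d i) w.
Proof.
by rewrite compress_hat !lcompA eps_sect_hat -!lcompA eps_sect_hat lcompf1 lcomp1f.
Qed.

Lemma bin_expand_hat x W (w : hom1 W (O i)) : hat x (a \c w) =
  hat (eta' d i) (a \c w)
    \v (lid a \h (hat (eps' d i) w \v hat (compress x) w \v hat (eps d i) w))
    \v hat (eta d i) (a \c w).
Proof.
rewrite -expand_hat -[LHS]lcomp1f -(eta_sect_bin d w) -lcompA.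
by have /= -> := hat_nat (eta d i) (hat x (a \c w)).
Qed.

Lemma compress_idem x : x \v x = x -> compress x \v compress x = compress x.
Proof.
move=> xx; apply: hat_inj => W w; rewrite hat_comp !compress_hat -!lcompA.
rewrite (lcompA (hat (eps' d i) w)) eps_sect_hat lcomp1f (lcompA (lid b \h _)).
by rewrite -whiskl -(hat_comp x x) xx.
Qed.

Lemma compress0_bin x : compress x = 0 ->
  forall W (w : hom1 W (O i)), hat x (a \c w) = 0.
Proof.
move=> x0 W w; rewrite bin_expand_hat x0.
by rewrite hat0 lcomp0l lcomp0r bimap0r lcomp0l lcomp0r.
Qed.

Lemma compress1_bin x : compress x = e i ->
  forall W (w : hom1 W (O i)), hat x (a \c w) = lid (a \c w).
Proof.
move=> x1 W w; rewrite bin_expand_hat x1 idem_eps_hat eps_sect_hat !whisk1 lcomp1f.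
exact: eta_sect_bin.
Qed.

End Compression.

Section IdempotentsOfSums.
Context {n : nat} {A : 'I_n -> C} {X : C}.
Context (indec : forall i, strongly_indecomposable (A i)).
Context (d : blocks (fun i => lid (id1 (A i))) X).

(** Compressed to the summand [A j], an idempotent is [0] or [1] because
    [End (Id_(A j))] is connected; so it kills or fixes the inclusion [eta' d j]
    of this summand of [id1 X]. *)
Lemma idem_eta' (x : id1 X ~> id1 X) : x \v x = x -> forall j,
  x \v eta' d j = 0 \/ x \v eta' d j = eta' d j.
Proof.
move=> /compress_idem xx j; have [_ _ /(_ _ (xx _ _ _ d j)) E] := indec j.
case: E => E; [left|right]; apply: hat_inj => W w; rewrite hatE;
  have /= -> := hat_nat x (hat (eta' d j) w).
- by rewrite (compress0_bin E) hat0 lcomp0r.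
- by rewrite (compress1_bin E) lcompf1.
Qed.

Definition idem_support (e : id1 X ~> id1 X) : {set 'I_n} :=
  [set j | `[< e \v eta' d j <> 0 >]].

Lemma idem_support_sum (e : id1 X ~> id1 X) : e \v e = e ->
  e = \sum_(j in idem_support e) (eta' d j \v eta d j).
Proof.
move=> ee; rewrite -[LHS]lcompf1 -(eta_sum d) lcomp_sumr.
rewrite [RHS]big_mkcond; apply: eq_bigr => j _; rewrite inE lcompA.
case: asboolP => [|/contrapT ->]; last by rewrite lcomp0l.
by case: (idem_eta' ee j) => ->.
Qed.

Lemma idem_supportI (u v : id1 X ~> id1 X) : u \v u = u -> v \v v = v ->
  idem_support (u \v v) = idem_support u :&: idem_support v.
Proof.
move=> uu vv; apply/setP => j; rewrite !inE -lcompA.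
have [->|->] := idem_eta' vv j; rewrite ?lcomp0r.
  by rewrite (asboolF (P := _ <> _)) ?andbF // => /(_ erefl).
case: (asboolP (u \v eta' d j <> 0)) => //= u0; apply/esym/asboolP => v0.
by apply: u0; rewrite v0 lcomp0r.
Qed.

Lemma split_idem (addC : additive_bicat C) (e : id1 X ~> id1 X) : e \v e = e ->
  exists T, inhabited (blocks (n := 1) (O := fun _ => X) (fun _ => e) T).
Proof.
move=> ee; rewrite (idem_support_sum ee) big_enum_val.
have [locC sumC] := addC.
set J := idem_support e.
have [T /dirsum_blocks [t]] := sumC _ (fun j : 'I_#|J| => A (enum_val j)).
exists T; constructor.
have [into dinto] := dirsum_choice (@locC X T)
  (fun j => bin t j \c bout d (enum_val j)).
have [from dfrom] := dirsum_choice (@locC T X)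
  (fun j => bin d (enum_val j) \c bout t j).
exact: (sub_blocks enum_val_inj dinto dfrom).
Qed.

End IdempotentsOfSums.

Lemma krull_schmidt_blocks : krull_schmidt C -> forall X,
  exists n (A : 'I_n -> C), (forall i, strongly_indecomposable (A i)) /\
    inhabited (blocks (fun i => lid (id1 (A i))) X).
Proof.
move=> [addC ksC] X; have [X0|nX0] := pselect (zero_object X).
  have noI (i : 'I_0) : False by case: i.
  exists 0, (fun i => match noI i with end); split=> [i|]; first by case: (noI i).
  by apply: dirsum_blocks; apply/object_dirsum0 => //; case: addC.
have [n [A [S [indec /dirsum_blocks [d] [f [g [[gf] [fg]]]]]]]] := ksC X nX0.
by exists n, A; split=> //; constructor; exact: (equiv_blocks d gf fg).
Qed.

End SplittingIdempotents.

(** * Sums of lax functors with the same values on objects *)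

(** The sum [t f] of the [L i f] inherits from the [L i] a composition by the
    diagonal maps [M i] and a unit by the [U i].  The coherence axioms hold
    because they hold after each projection.  The unit of a single [L i] need not
    be invertible, as [L i (id1 X)] is isomorphic to a summand [V i] of the
    identity; summed over [i] it is, and so is the composition, because the
    off-diagonal composites vanish. *)
Section SumOfLaxFunctors.
Context {k : comPzRingType} {B C : bicat k} {N : B -> C} {n : nat}.
Context (L : 'I_n -> forall X Y : B, linfunctor (hom1 X Y) (hom1 (N X) (N Y))).
Context (M : forall i (X Y Z : B) (g : hom1 Y Z) (f : hom1 X Y),
  liniso (L i Y Z g \c L i X Y f) (L i X Z (g \c f))).
Context (V : 'I_n -> forall X : B, hom1 (N X) (N X)).
Context (dV : forall X : B, dirsum_data (fun i => V i X) (id1 (N X))).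
Context (U : forall i (X : B), liniso (V i X) (L i X X (id1 X))).

Hypothesis off : forall (X Y Z : B) (g : hom1 Y Z) (f : hom1 X Y) i j,
  i != j -> lid (L i Y Z g \c L j X Y f) = 0.
Hypothesis M_nat : forall i (X Y Z : B) (g g' : hom1 Y Z) (f f' : hom1 X Y)
    (v : g ~> g') (u : f ~> f'),
  fwd (M i g' f') \v (fmap (L i Y Z) v \h fmap (L i X Y) u) =
  fmap (L i X Z) (v \h u) \v fwd (M i g f).
Hypothesis M_assoc : forall i (X Y Z W : B) (h : hom1 Z W) (g : hom1 Y Z)
    (f : hom1 X Y),
  fmap (L i X W) (fwd (assoc h g f)) \v fwd (M i (h \c g) f)
    \v (fwd (M i h g) \h lid (L i X Y f)) =
  fwd (M i h (g \c f)) \v (lid (L i Z W h) \h fwd (M i g f))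
    \v fwd (assoc (L i Z W h) (L i Y Z g) (L i X Y f)).
Hypothesis M_lunit : forall i (X Y : B) (f : hom1 X Y),
  fmap (L i X Y) (fwd (lunit f)) \v fwd (M i (id1 Y) f)
    \v ((fwd (U i Y) \v dproj (dV Y) i) \h lid (L i X Y f)) =
  fwd (lunit (L i X Y f)).
Hypothesis M_runit : forall i (X Y : B) (f : hom1 X Y),
  fmap (L i X Y) (fwd (runit f)) \v fwd (M i f (id1 X))
    \v (lid (L i X Y f) \h (fwd (U i X) \v dproj (dV X) i)) =
  fwd (runit (L i X Y f)).

Context (t : forall X Y : B, hom1 X Y -> hom1 (N X) (N Y)).
Context (s : forall (X Y : B) (f : hom1 X Y),
  dirsum_data (fun i => L i X Y f) (t f)).

Definition laxsum_map X Y (f f' : hom1 X Y) (u : f ~> f') : t f ~> t f' :=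
  dsum_map (s f) (s f') (fun i => fmap (L i X Y) u).

Lemma dproj_laxsum_map X Y (f f' : hom1 X Y) (u : f ~> f') i :
  dproj (s f') i \v laxsum_map u = fmap (L i X Y) u \v dproj (s f) i.
Proof. exact: dproj_map. Qed.

Lemma laxsum_map1 X Y (f : hom1 X Y) : laxsum_map (lid f) = lid (t f).
Proof.
apply: (dproj_monic (s f)) => i.
by rewrite dproj_laxsum_map fmap1 lcomp1f lcompf1.
Qed.

Lemma laxsum_mapM X Y (f f' f'' : hom1 X Y) (v : f' ~> f'') (u : f ~> f') :
  laxsum_map (v \v u) = laxsum_map v \v laxsum_map u.
Proof.
apply: (dproj_monic (s f'')) => i; rewrite dproj_laxsum_map fmapM.
by rewrite lcompA dproj_laxsum_map -!lcompA dproj_laxsum_map.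
Qed.

Lemma laxsum_map_linear X Y (f f' : hom1 X Y) :
  linear (@laxsum_map X Y f f').
Proof.
move=> a u v; apply: (dproj_monic (s f')) => i.
rewrite lcomp_linearr !dproj_laxsum_map (fmap_linear (L i X Y) a).
by rewrite lcomp_linearl.
Qed.

Definition laxsum_hom X Y : linfunctor (hom1 X Y) (hom1 (N X) (N Y)) :=
  @LinFunctor k (hom1 X Y) (hom1 (N X) (N Y)) (@t X Y) (@laxsum_map X Y)
    (@laxsum_map1 X Y) (@laxsum_mapM X Y) (@laxsum_map_linear X Y).

Definition laxsum_comp X Y Z (g : hom1 Y Z) (f : hom1 X Y) :
    liniso (t g \c t f) (t (g \c f)) :=
  dsum_iso (comp_dirsum (s g) (s f) (off g f)) (s (g \c f)) (fun i => M i g f).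

Lemma dproj_laxsum_comp X Y Z (g : hom1 Y Z) (f : hom1 X Y) i :
  dproj (s (g \c f)) i \v fwd (laxsum_comp g f) =
  fwd (M i g f) \v (dproj (s g) i \h dproj (s f) i).
Proof. exact: dproj_iso. Qed.

Definition laxsum_unit X : liniso (id1 (N X)) (t (id1 X)) :=
  dsum_iso (dV X) (s (id1 X)) (fun i => U i X).

Lemma dproj_laxsum_unit X i :
  dproj (s (id1 X)) i \v fwd (laxsum_unit X) = fwd (U i X) \v dproj (dV X) i.
Proof. exact: dproj_iso. Qed.

Lemma laxsum_comp_nat X Y Z (g g' : hom1 Y Z) (f f' : hom1 X Y)
    (v : g ~> g') (u : f ~> f') :
  fwd (laxsum_comp g' f') \v (laxsum_map v \h laxsum_map u) =
  laxsum_map (v \h u) \v fwd (laxsum_comp g f).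
Proof.
apply: (dproj_monic (s _)) => i.
rewrite (lcomp_eql (dproj_laxsum_comp _ _ _)) -lcompA -bimapM.
rewrite !dproj_laxsum_map bimapM lcompA M_nat.
rewrite (lcomp_eql (dproj_laxsum_map _ _)) -!lcompA.
by rewrite dproj_laxsum_comp.
Qed.

Lemma laxsum_assoc X Y Z W (h : hom1 Z W) (g : hom1 Y Z) (f : hom1 X Y) :
  laxsum_map (fwd (assoc h g f)) \v fwd (laxsum_comp (h \c g) f)
    \v (fwd (laxsum_comp h g) \h lid (t f)) =
  fwd (laxsum_comp h (g \c f)) \v (lid (t h) \h fwd (laxsum_comp g f))
    \v fwd (assoc (t h) (t g) (t f)).
Proof.
apply: (dproj_monic (s _)) => i.
rewrite (lcomp_eql (dproj_laxsum_map _ _)) -lcompA.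
rewrite (lcomp_eql (dproj_laxsum_comp _ _ _)) -lcompA -bimapM.
rewrite dproj_laxsum_comp lcompf1 -[dproj (s f) i in LHS]lcomp1f bimapM.
rewrite (lcomp_eql3 (M_assoc _ _ _ _)) -!lcompA assoc_nat.
rewrite (lcomp_eql (dproj_laxsum_comp _ _ _)) -lcompA; congr (_ \v _).
rewrite 2!lcompA; congr (_ \v _).
by rewrite -!bimapM lcomp1f lcompf1 dproj_laxsum_comp.
Qed.

Lemma laxsum_lunit X Y (f : hom1 X Y) :
  laxsum_map (fwd (lunit f)) \v fwd (laxsum_comp (id1 Y) f)
    \v (fwd (laxsum_unit Y) \h lid (t f)) = fwd (lunit (t f)).
Proof.
apply: (dproj_monic (s _)) => i.
rewrite (lcomp_eql (dproj_laxsum_map _ _)) -lcompA.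
rewrite (lcomp_eql (dproj_laxsum_comp _ _ _)) -lcompA -bimapM.
rewrite dproj_laxsum_unit lcompf1 -[dproj (s f) i in LHS]lcomp1f.
rewrite -[X in X \h _]lcompf1 bimapM.
by rewrite (lcomp_eql3 (M_lunit _ _)) lunit_nat.
Qed.

Lemma laxsum_runit X Y (f : hom1 X Y) :
  laxsum_map (fwd (runit f)) \v fwd (laxsum_comp f (id1 X))
    \v (lid (t f) \h fwd (laxsum_unit X)) = fwd (runit (t f)).
Proof.
apply: (dproj_monic (s _)) => i.
rewrite (lcomp_eql (dproj_laxsum_map _ _)) -lcompA.
rewrite (lcomp_eql (dproj_laxsum_comp _ _ _)) -lcompA -bimapM.
rewrite dproj_laxsum_unit lcompf1 -[dproj (s f) i in LHS]lcomp1f.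
rewrite -[X in _ \h X]lcompf1 bimapM.
by rewrite (lcomp_eql3 (M_runit _ _)) runit_nat.
Qed.

Definition laxsum : pseudofunctor B C :=
  @PseudoFunctor k B C N laxsum_hom (@laxsum_comp) laxsum_unit
    (@laxsum_comp_nat) (@laxsum_assoc) (@laxsum_lunit) (@laxsum_runit).

End SumOfLaxFunctors.

Section HatIsos.
Context {k : comPzRingType} {C : bicat k}.

Lemma hat_fwdK (X Y : C) (f g : nform X Y) (u : liniso f g) W (w : hom1 W X) :
  hat (bwd u) w \v hat (fwd u) w = lid (act f w).
Proof. by rewrite -hat_comp fwdK hat_id. Qed.

Lemma hat_bwdK (X Y : C) (f g : nform X Y) (u : liniso f g) W (w : hom1 W X) :
  hat (fwd u) w \v hat (bwd u) w = lid (act g w).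
Proof. by rewrite -hat_comp bwdK hat_id. Qed.

End HatIsos.

(** * The pseudofunctor assembled from pointwise blocks *)
Section PointwiseBlocks.
Context {k : comPzRingType} {B C : bicat k} {n : nat}.
Context (O : 'I_n -> pseudofunctor B C).
Context (e : forall i (X : B), id1 (O i X) ~> id1 (O i X)).
Context (eP : forall i, @is_modification _ _ _ _ _ (pn_id (O i)) (pn_id (O i)) (e i)).
Context (N : B -> C).
Context (d : forall X, blocks (O := fun i => O i X) (fun i => e i X) (N X)).
Context (tri : forall X, triangles (d X)).
Local Notation a X i := (bin (d X) i).
Local Notation b X i := (bout (d X) i).
Local Notation "F @1 f" := (pfhom F f) (at level 40, no associativity).

Lemma bin_eps_eta X i W (w : hom1 W (O i X)) :
  (lid (a X i) \h hat (eps (d X) i) w) \v hat (eta (d X) i) (a X i \c w) =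
  lid (a X i \c w).
Proof. exact: (tri X).1. Qed.

Lemma eps_eta_bout X i W (w : hom1 W (N X)) :
  hat (eps (d X) i) (b X i \c w) \v (lid (b X i) \h hat (eta (d X) i) w) =
  lid (b X i \c w).
Proof. exact: (tri X).2. Qed.

Lemma idem_nat_hat X Y (f : hom1 X Y) i W (w : hom1 W (O i X)) :
  lid (O i @1 f) \h hat (e i X) w = hat (e i Y) (O i @1 f \c w).
Proof.
have E : (bwd (lunit (O i @1 f)) \v fwd (runit (O i @1 f)))
      \v (lid (O i @1 f) \h e i X) =
    (e i Y \h lid (O i @1 f))
      \v (bwd (lunit (O i @1 f)) \v fwd (runit (O i @1 f))) := eP i f.
by have := congr1 (fun u => hat u w) E; hat_simpl.
Qed.

Lemma bin_O_idem X Y (f : hom1 X Y) i W (w : hom1 W (O i X)) :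
  lid (a Y i) \h (lid (O i @1 f) \h hat (e i X) w) = lid (a Y i \c O i @1 f \c w).
Proof. by rewrite idem_nat_hat bin_idem. Qed.

Local Notation corner_ob i f := (a _ i \c (O i @1 f \c b _ i)).

Definition corner_map i X Y (f f' : hom1 X Y) (u : f ~> f') :
    corner_ob i f ~> corner_ob i f' :=
  lid (a Y i) \h (fmap (pfhom (O i)) u \h lid (b X i)).

Lemma corner_map1 i X Y (f : hom1 X Y) :
  corner_map i (lid f) = lid (corner_ob i f).
Proof. by rewrite /corner_map fmap1 !whisk1. Qed.

Lemma corner_mapM i X Y (f f' f'' : hom1 X Y) (v : f' ~> f'') (u : f ~> f') :
  corner_map i (v \v u) = corner_map i v \v corner_map i u.
Proof. by rewrite /corner_map fmapM whiskr whiskl. Qed.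

Lemma corner_map_linear i X Y (f f' : hom1 X Y) :
  linear (@corner_map i X Y f f').
Proof.
move=> c u v; rewrite /corner_map (fmap_linear (pfhom (O i)) c).
by rewrite (bimap_linearl _ _ c) (bimap_linearr _ _ c).
Qed.

Definition corner i X Y : linfunctor (hom1 X Y) (hom1 (N X) (N Y)) :=
  @LinFunctor k (hom1 X Y) (hom1 (N X) (N Y)) (fun f => corner_ob i f)
    (@corner_map i X Y) (@corner_map1 i X Y) (@corner_mapM i X Y)
    (@corner_map_linear i X Y).

(** The composition of the lax functor [f |-> a (O f) b]: contract the inner
    [b a] by the counit [eps], then compose in [O]. *)
Definition corner_comp_fwd i X Y Z (g : hom1 Y Z) (f : hom1 X Y) :
    corner_ob i g \c corner_ob i f ~> corner_ob i (g \c f) :=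
  (lid (a Z i) \h ((fwd (pfcomp (O i) g f) \h lid (b X i))
     \v bwd (assoc (O i @1 g) (O i @1 f) (b X i))
     \v (lid (O i @1 g) \h (fwd (lunit (O i @1 f \c b X i)) \v (eps (d Y) i \h lid _)
          \v bwd (assoc (b Y i) (a Y i) (O i @1 f \c b X i))))
     \v fwd (assoc (O i @1 g) (b Y i) (corner_ob i f))))
  \v fwd (assoc (a Z i) (O i @1 g \c b Y i) (corner_ob i f)).

Lemma corner_comp_fwd_hat i X Y Z (g : hom1 Y Z) (f : hom1 X Y) W
    (w : hom1 W (N X)) :
  hat (corner_comp_fwd i g f) w =
  (lid (a Z i) \h hat (fwd (pfcomp (O i) g f)) (b X i \c w))
  \v (lid (a Z i) \h (lid (O i @1 g) \h
       hat (eps (d Y) i) (O i @1 f \c b X i \c w))).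
Proof. by rewrite /corner_comp_fwd; hat_simpl; rewrite whiskl. Qed.

Definition corner_comp_bwd i X Y Z (g : hom1 Y Z) (f : hom1 X Y) :
    corner_ob i (g \c f) ~> corner_ob i g \c corner_ob i f :=
  bwd (assoc (a Z i) (O i @1 g \c b Y i) (corner_ob i f))
  \v (lid (a Z i) \h (bwd (assoc (O i @1 g) (b Y i) (corner_ob i f))
     \v (lid (O i @1 g) \h (fwd (assoc (b Y i) (a Y i) (O i @1 f \c b X i))
          \v (eps' (d Y) i \h lid _) \v bwd (lunit _)))
     \v fwd (assoc (O i @1 g) (O i @1 f) (b X i))
     \v (bwd (pfcomp (O i) g f) \h lid (b X i)))).

Lemma corner_comp_bwd_hat i X Y Z (g : hom1 Y Z) (f : hom1 X Y) W
    (w : hom1 W (N X)) :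
  hat (corner_comp_bwd i g f) w =
  (lid (a Z i) \h (lid (O i @1 g) \h
       hat (eps' (d Y) i) (O i @1 f \c b X i \c w)))
  \v (lid (a Z i) \h hat (bwd (pfcomp (O i) g f)) (b X i \c w)).
Proof. by rewrite /corner_comp_bwd; hat_simpl; rewrite whiskl. Qed.

Lemma corner_comp_fwdK i X Y Z (g : hom1 Y Z) (f : hom1 X Y) :
  corner_comp_bwd i g f \v corner_comp_fwd i g f = lid _.
Proof.
apply: hat_inj => W w; rewrite hat_comp corner_comp_fwd_hat corner_comp_bwd_hat.
rewrite -!lcompA (lcompA (_ \h hat (bwd (pfcomp (O i) g f)) _)) -whiskl hat_fwdK whisk1 lcomp1f.
by rewrite -!whiskl eps_sect_hat !whisk1 hat_id.
Qed.

(** Here naturality of the idempotent enters: [eps eps' = e] sits between [O g] and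
    [O f], and can be moved past [O f] onto [b], where it is the identity. *)
Lemma corner_comp_bwdK i X Y Z (g : hom1 Y Z) (f : hom1 X Y) :
  corner_comp_fwd i g f \v corner_comp_bwd i g f = lid _.
Proof.
apply: hat_inj => W w; rewrite hat_comp corner_comp_fwd_hat corner_comp_bwd_hat.
rewrite -!lcompA (lcompA (_ \h (_ \h hat (eps (d Y) i) _))) -!whiskl eps_idem_hat.
rewrite -(idem_nat_hat f) idem_bout.
by rewrite !whisk1 lcomp1f (hat_bwdK (pfcomp (O i) g f)) whisk1 hat_id.
Qed.

Definition corner_comp i X Y Z (g : hom1 Y Z) (f : hom1 X Y) :
    liniso (corner i Y Z g \c corner i X Y f) (corner i X Z (g \c f)) :=
  LinIso (corner_comp_fwdK i g f) (corner_comp_bwdK i g f).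

Lemma corner_off X Y Z (g : hom1 Y Z) (f : hom1 X Y) i j :
  i != j -> lid (corner i Y Z g \c corner j X Y f) = 0.
Proof.
move=> nij; rewrite /=; apply: hat_inj => W w; rewrite hat0 hat_id /=.
by rewrite -(whisk1 (a Z i)) -(whisk1 (O i @1 g)) bout_bin0_hat // !bimap0r.
Qed.

Lemma corner_comp_nat i X Y Z (g g' : hom1 Y Z) (f f' : hom1 X Y)
    (v : g ~> g') (u : f ~> f') :
  corner_comp_fwd i g' f' \v (corner_map i v \h corner_map i u) =
  corner_map i (v \h u) \v corner_comp_fwd i g f.
Proof.
apply: hat_inj => W w; rewrite hat_comp corner_comp_fwd_hat.
rewrite [in RHS]hat_comp corner_comp_fwd_hat /corner_map.
have := congr1 (fun x => hat x (b X i \c w)) (pfcomp_nat (O i) v u).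
hat_simpl => E; rewrite -!whiskl; congr (_ \h _).
have /= E1 := hat_nat (fmap (pfhom (O i)) v)
  (hat (eps (d Y) i) (O i @1 f' \c b X i \c w)).
have /= E2 := hat_nat (eps (d Y) i) (hat (fmap (pfhom (O i)) u) (b X i \c w)).
rewrite -!lcompA (lcompA (lid _ \h hat (eps _ _) _)) -E1 -lcompA -whiskl E2.
by rewrite whiskl (lcomp_eql3 E) -lcompA.
Qed.

Lemma corner_comp_assoc i X Y Z W (h : hom1 Z W) (g : hom1 Y Z) (f : hom1 X Y) :
  corner_map i (fwd (assoc h g f)) \v corner_comp_fwd i (h \c g) f
    \v (corner_comp_fwd i h g \h lid (corner_ob i f)) =
  corner_comp_fwd i h (g \c f)
    \v (lid (corner_ob i h) \h corner_comp_fwd i g f)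
    \v fwd (assoc (corner_ob i h) (corner_ob i g) (corner_ob i f)).
Proof.
apply: hat_inj => V w; rewrite /corner_map.
rewrite !(corner_comp_fwd_hat, hatE) /=.
have := congr1 (fun x => hat x (b X i \c w)) (pfassoc (O i) h g f).
hat_simpl => E.
have /= E1 := hat_nat (fwd (pfcomp (O i) h g))
  (hat (eps (d Y) i) (O i @1 f \c b X i \c w)).
have /= E2 := hat_nat (eps (d Z) i) (hat (fwd (pfcomp (O i) g f)) (b X i \c w)
  \v (lid (O i @1 g) \h hat (eps (d Y) i) (O i @1 f \c b X i \c w))).
rewrite -!whiskl; congr (_ \h _); rewrite -!lcompA.
rewrite (lcompA (lid (O i @1 (h \c g)) \h _)) -E1 -lcompA (lcomp_eql3 E).
by rewrite -!lcompA; congr (_ \v _); rewrite -!whiskl E2 -lcompA.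
Qed.

Definition corner_unit_iso i X : liniso (a X i \c b X i) (corner_ob i (id1 X)) :=
  lwhisk (a X i) (liniso_comp (rwhisk (b X i) (pfunit (O i) X))
    (liniso_inv (lunit (b X i)))).

Lemma corner_unit_hat i X W (w : hom1 W (N X)) :
  hat (fwd (corner_unit_iso i X) \v eta (d X) i) w =
  (lid (a X i) \h hat (fwd (pfunit (O i) X)) (b X i \c w)) \v hat (eta (d X) i) w.
Proof. by rewrite /=; hat_simpl. Qed.

(** The unit axioms of the lax functor are where the triangle identities are
    needed, one for each of the two. *)
Lemma corner_lunit i X Y (f : hom1 X Y) :
  corner_map i (fwd (lunit f)) \v corner_comp_fwd i (id1 Y) f
    \v ((fwd (corner_unit_iso i Y) \v eta (d Y) i) \h lid (corner_ob i f)) =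
  fwd (lunit (corner_ob i f)).
Proof.
apply: hat_inj => V w; rewrite /corner_map.
rewrite !(corner_comp_fwd_hat, corner_unit_hat, hatE) /=.
have := congr1 (fun x => hat x (b X i \c w)) (pflunit (O i) f).
hat_simpl => E.
have /= E1 := hat_nat (fwd (pfunit (O i) Y))
  (hat (eps (d Y) i) (O i @1 f \c b X i \c w)).
rewrite -!lcompA (lcompA (lid _ \h (lid _ \h hat (eps _ _) _))) -whiskl -E1.
rewrite whiskl -lcompA bin_eps_eta lcompf1 -!whiskl E.
exact: whisk1.
Qed.

Lemma corner_runit i X Y (f : hom1 X Y) :
  corner_map i (fwd (runit f)) \v corner_comp_fwd i f (id1 X)
    \v (lid (corner_ob i f) \h (fwd (corner_unit_iso i X) \v eta (d X) i)) =
  fwd (runit (corner_ob i f)).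
Proof.
apply: hat_inj => V w; rewrite /corner_map.
rewrite !(corner_comp_fwd_hat, corner_unit_hat, hatE) /=.
have := congr1 (fun x => hat x (b X i \c w)) (pfrunit (O i) f).
hat_simpl => E.
have /= E1 := hat_nat (eps (d X) i) (hat (fwd (pfunit (O i) X)) (b X i \c w)).
rewrite -!whiskl -[X in _ = X]whisk1; congr (_ \h _); rewrite -!lcompA.
rewrite whiskl -whiskl (lcompA (hat (eps _ _) _)) E1 -lcompA eps_eta_bout lcompf1.
exact: E.
Qed.

Context (t : forall X Y : B, hom1 X Y -> hom1 (N X) (N Y)).
Context (s : forall (X Y : B) (f : hom1 X Y),
  dirsum_data (fun i => corner i X Y f) (t f)).

Definition block_functor : pseudofunctor B C :=
  laxsum (L := corner) (M := corner_comp) (dV := fun X => blocks_sum (d X))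
    (U := corner_unit_iso) corner_off corner_comp_nat corner_comp_assoc
    corner_lunit corner_runit s.

Lemma block_functor_map X Y (f f' : hom1 X Y) (u : f ~> f') i :
  dproj (s f') i \v fmap (pfhom block_functor) u =
  corner_map i u \v dproj (s f) i.
Proof. exact: dproj_laxsum_map. Qed.

Lemma block_functor_comp X Y Z (g : hom1 Y Z) (f : hom1 X Y) i :
  dproj (s (g \c f)) i \v fwd (pfcomp block_functor g f) =
  corner_comp_fwd i g f \v (dproj (s g) i \h dproj (s f) i).
Proof. exact: dproj_laxsum_comp. Qed.

Lemma block_functor_unit X i :
  dproj (s (id1 X)) i \v fwd (pfunit block_functor X) =
  fwd (corner_unit_iso i X) \v eta (d X) i.
Proof. exact: dproj_laxsum_unit. Qed.

End PointwiseBlocks.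

Definition single_iso (k : comPzRingType) (D : lincat k) n (a : 'I_n -> D) s
    (d : dirsum_data a s) i (off : forall j, j != i -> lid (a j) = 0) :
    liniso s (a i).
Proof.
refine (@LinIso _ _ _ _ (dproj d i) (dinj d i) _ (dinjK d i)).
abstract (by rewrite -(dsum_id d) [in RHS](bigD1 i) //= big1 ?addr0 // => j nji;
  apply: lcomp_through0; apply: off).
Defined.

(** * The legs of the blocks as pseudonatural transformations *)

(** The pseudofunctor [N] enters only through its values [N f] as direct sums and
    through its structure cells after projection, as given by the three
    hypotheses below. *)
Section BlockTransformations.
Context {k : comPzRingType} {B C : bicat k} {n : nat}.
Context (O : 'I_n -> pseudofunctor B C) (N : pseudofunctor B C).
Context (e : forall i (X : B), id1 (O i X) ~> id1 (O i X)).
Context (eP : forall i,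
  @is_modification _ _ _ _ _ (pn_id (O i)) (pn_id (O i)) (e i)).
Context (d : forall X, blocks (O := fun i => O i X) (fun i => e i X) (N X)).
Context (tri : forall X, triangles (d X)).
Local Notation a X i := (bin (d X) i).
Local Notation b X i := (bout (d X) i).
Local Notation "F @1 f" := (pfhom F f) (at level 40, no associativity).
Context (s : forall (X Y : B) (f : hom1 X Y),
  dirsum_data (fun i => a Y i \c (O i @1 f \c b X i)) (N @1 f)).
(** The projections and injections of [s f], typed by explicit composites of
    1-cells, so that [hat] brackets their sources and targets. *)
Definition nproj X Y (f : hom1 X Y) i :
  N @1 f ~> a Y i \c (O i @1 f \c b X i) := dproj (s f) i.
Definition ninj X Y (f : hom1 X Y) i :
  a Y i \c (O i @1 f \c b X i) ~> N @1 f := dinj (s f) i.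
Hypothesis N_map : forall (X Y : B) (f f' : hom1 X Y) (u : f ~> f') i,
  nproj f' i \v fmap (pfhom N) u = corner_map d i u \v nproj f i.
Hypothesis N_comp : forall (X Y Z : B) (g : hom1 Y Z) (f : hom1 X Y) i,
  nproj (g \c f) i \v fwd (pfcomp N g f) =
  corner_comp_fwd d i g f \v (nproj g i \h nproj f i).
Hypothesis N_unit : forall X i,
  nproj (id1 X) i \v fwd (pfunit N X) =
  fwd (corner_unit_iso d i X) \v eta (d X) i.

Lemma N_map_hat X Y (f f' : hom1 X Y) (u : f ~> f') i W (w : hom1 W (N X)) :
  hat (nproj f' i) w \v hat (fmap (pfhom N) u) w =
  (lid (a Y i) \h hat (fmap (pfhom (O i)) u) (b X i \c w))
    \v hat (nproj f i) w.
Proof.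
have := congr1 (fun x => hat x w) (N_map u i); rewrite /corner_map.
by hat_simpl.
Qed.

Lemma N_comp_hat X Y Z (g : hom1 Y Z) (f : hom1 X Y) i W (w : hom1 W (N X)) :
  hat (nproj (g \c f) i) w \v hat (fwd (pfcomp N g f)) w =
  (lid (a Z i) \h hat (fwd (pfcomp (O i) g f)) (b X i \c w))
  \v (lid (a Z i) \h (lid (O i @1 g) \h
       hat (eps (d Y) i) (O i @1 f \c b X i \c w)))
  \v hat (nproj g i) (a Y i \c (O i @1 f \c b X i \c w))
  \v (lid (N @1 g) \h hat (nproj f i) w).
Proof.
have := congr1 (fun x => hat x w) (N_comp g f i).
by rewrite !(corner_comp_fwd_hat, hatE) /= -!lcompA.
Qed.

Lemma N_unit_hat X i W (w : hom1 W (N X)) :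
  hat (nproj (id1 X) i) w \v hat (fwd (pfunit N X)) w =
  (lid (a X i) \h hat (fwd (pfunit (O i) X)) (b X i \c w)) \v hat (eta (d X) i) w.
Proof.
have := congr1 (fun x => hat x w) (N_unit X i).
by rewrite !(corner_unit_hat, hatE) /=.
Qed.

Section In.
Context (i : 'I_n).

Definition in_corner_fwd X Y (f : hom1 X Y) :
    (a Y i \c (O i @1 f \c b X i)) \c a X i ~> a Y i \c O i @1 f :=
  (lid (a Y i) \h (fwd (runit (O i @1 f)) \v (lid (O i @1 f) \h eps (d X) i)
                    \v fwd (assoc (O i @1 f) (b X i) (a X i))))
  \v fwd (assoc (a Y i) (O i @1 f \c b X i) (a X i)).

Definition in_corner_bwd X Y (f : hom1 X Y) :
    a Y i \c O i @1 f ~> (a Y i \c (O i @1 f \c b X i)) \c a X i :=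
  bwd (assoc (a Y i) (O i @1 f \c b X i) (a X i))
  \v (lid (a Y i) \h (bwd (assoc (O i @1 f) (b X i) (a X i))
                       \v (lid (O i @1 f) \h eps' (d X) i)
                       \v bwd (runit (O i @1 f)))).

Lemma in_corner_fwd_hat X Y (f : hom1 X Y) W (w : hom1 W (O i X)) :
  hat (in_corner_fwd f) w = lid (a Y i) \h (lid (O i @1 f) \h hat (eps (d X) i) w).
Proof. by rewrite /in_corner_fwd; hat_simpl. Qed.

Lemma in_corner_bwd_hat X Y (f : hom1 X Y) W (w : hom1 W (O i X)) :
  hat (in_corner_bwd f) w = lid (a Y i) \h (lid (O i @1 f) \h hat (eps' (d X) i) w).
Proof. by rewrite /in_corner_bwd; hat_simpl. Qed.

Lemma in_corner_fwdK X Y (f : hom1 X Y) :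
  in_corner_bwd f \v in_corner_fwd f = lid _.
Proof.
apply: hat_inj => W w; rewrite hat_comp in_corner_fwd_hat in_corner_bwd_hat.
by rewrite -!whiskl eps_sect_hat !whisk1 hat_id.
Qed.

Lemma in_corner_bwdK X Y (f : hom1 X Y) :
  in_corner_fwd f \v in_corner_bwd f = lid _.
Proof.
apply: hat_inj => W w; rewrite hat_comp in_corner_fwd_hat in_corner_bwd_hat.
by rewrite -!whiskl eps_idem_hat (bin_O_idem eP) hat_id.
Qed.

Definition in_corner X Y (f : hom1 X Y) := LinIso (in_corner_fwdK f) (in_corner_bwdK f).

Lemma in_off X Y (f : hom1 X Y) j : j != i ->
  lid ((a Y j \c (O j @1 f \c b X j)) \c a X i) = 0.
Proof.
move=> nji; apply: hat_inj => W w; rewrite hat0 hat_id /=.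
by rewrite -(whisk1 (a Y j)) -(whisk1 (O j @1 f)) bout_bin0_hat // !bimap0r.
Qed.

(** Composed with [a X i], the sum [N f] keeps only its [i]-th summand, from which
    [b a] is contracted. *)
Definition in_cell X Y (f : hom1 X Y) : liniso (N @1 f \c a X i) (a Y i \c O i @1 f) :=
  liniso_comp (in_corner f)
    (@single_iso _ _ _ _ _ (rwhisk_dirsum (a X i) (s f)) i (@in_off _ _ f)).

Lemma in_cell_hat X Y (f : hom1 X Y) W (w : hom1 W (O i X)) :
  hat (fwd (in_cell f)) w =
  (lid (a Y i) \h (lid (O i @1 f) \h hat (eps (d X) i) w))
    \v hat (nproj f i) (a X i \c w).
Proof. by rewrite /in_cell /= -?/(nproj _ _) -?/(ninj _ _) !(in_corner_fwd_hat, hatE) /= lcompf1. Qed.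

Lemma in_cell_bwd_hat X Y (f : hom1 X Y) W (w : hom1 W (O i X)) :
  hat (bwd (in_cell f)) w = hat (ninj f i) (a X i \c w)
    \v (lid (a Y i) \h (lid (O i @1 f) \h hat (eps' (d X) i) w)).
Proof. by rewrite /in_cell /= -?/(nproj _ _) -?/(ninj _ _) !(in_corner_bwd_hat, hatE) /= lcompf1. Qed.

Lemma in_nat X Y (f f' : hom1 X Y) (u : f ~> f') :
  fwd (in_cell f') \v (fmap (pfhom N) u \h lid (a X i)) =
  (lid (a Y i) \h fmap (pfhom (O i)) u) \v fwd (in_cell f).
Proof.
apply: hat_inj => W w; rewrite !(in_cell_hat, hatE) /= !lcompf1 lcomp1f.
rewrite -lcompA N_map_hat !lcompA -!whiskl.
by have /= -> := hat_nat (fmap (pfhom (O i)) u) (hat (eps (d X) i) w).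
Qed.

Lemma in_unit X :
  fwd (in_cell (id1 X)) \v (fwd (pfunit N X) \h lid (a X i)) =
  (lid (a X i) \h fwd (pfunit (O i) X))
    \v bwd (runit (a X i)) \v fwd (lunit (a X i)).
Proof.
apply: hat_inj => W w; rewrite !(in_cell_hat, hatE) /= !lcompf1 lcomp1f.
rewrite -lcompA N_unit_hat lcompA -whiskl.
have /= <- := hat_nat (fwd (pfunit (O i) X)) (hat (eps (d X) i) w).
by rewrite whiskl -lcompA bin_eps_eta // lcompf1.
Qed.

Lemma in_comp X Y Z (g : hom1 Y Z) (f : hom1 X Y) :
  fwd (in_cell (g \c f)) \v (fwd (pfcomp N g f) \h lid (a X i)) =
  (lid (a Z i) \h fwd (pfcomp (O i) g f))
    \v fwd (assoc (a Z i) (O i @1 g) (O i @1 f))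
    \v (fwd (in_cell g) \h lid (O i @1 f))
    \v bwd (assoc (N @1 g) (a Y i) (O i @1 f))
    \v (lid (N @1 g) \h fwd (in_cell f))
    \v fwd (assoc (N @1 g) (N @1 f) (a X i)).
Proof.
apply: hat_inj => W w; rewrite !(in_cell_hat, hatE) /= !lcompf1 !lcomp1f.
rewrite -!lcompA N_comp_hat whiskl.
have /= E1 := hat_nat (nproj g i)
  (lid (a Y i) \h (lid (O i @1 f) \h hat (eps (d X) i) w)).
have /= E2 := hat_nat (fwd (pfcomp (O i) g f)) (hat (eps (d X) i) w).
have /= E3 := hat_nat (eps (d Y) i) (lid (O i @1 f) \h hat (eps (d X) i) w).
rewrite (lcompA (hat (nproj g i) _)) E1 -lcompA.
by rewrite !lcompA -!whiskl -E2 -!(lcompA (hat (fwd (pfcomp (O i) g f)) w)) -!whiskl E3.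
Qed.

Definition block_in : pseudonat (O i) N := PseudoNat in_nat in_unit in_comp.

End In.

Section Out.
Context (i : 'I_n).

Definition out_corner_fwd X Y (f : hom1 X Y) :
    O i @1 f \c b X i ~> b Y i \c (a Y i \c (O i @1 f \c b X i)) :=
  fwd (assoc _ _ _) \v (eps' (d Y) i \h lid (O i @1 f \c b X i))
    \v bwd (lunit (O i @1 f \c b X i)).

Definition out_corner_bwd X Y (f : hom1 X Y) :
    b Y i \c (a Y i \c (O i @1 f \c b X i)) ~> O i @1 f \c b X i :=
  fwd (lunit (O i @1 f \c b X i))
    \v (eps (d Y) i \h lid (O i @1 f \c b X i)) \v bwd (assoc _ _ _).

Lemma out_corner_fwd_hat X Y (f : hom1 X Y) W (w : hom1 W (N X)) :
  hat (out_corner_fwd f) w = hat (eps' (d Y) i) (O i @1 f \c b X i \c w).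
Proof. by rewrite /out_corner_fwd; hat_simpl. Qed.

Lemma out_corner_bwd_hat X Y (f : hom1 X Y) W (w : hom1 W (N X)) :
  hat (out_corner_bwd f) w = hat (eps (d Y) i) (O i @1 f \c b X i \c w).
Proof. by rewrite /out_corner_bwd; hat_simpl. Qed.

Lemma out_corner_fwdK X Y (f : hom1 X Y) :
  out_corner_bwd f \v out_corner_fwd f = lid _.
Proof.
apply: hat_inj => W w; rewrite hat_comp out_corner_fwd_hat out_corner_bwd_hat.
by rewrite eps_idem_hat -(idem_nat_hat eP) idem_bout whisk1 hat_id.
Qed.

Lemma out_corner_bwdK X Y (f : hom1 X Y) :
  out_corner_fwd f \v out_corner_bwd f = lid _.
Proof.
apply: hat_inj => W w; rewrite hat_comp out_corner_fwd_hat out_corner_bwd_hat.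
by rewrite eps_sect_hat hat_id.
Qed.

Definition out_corner X Y (f : hom1 X Y) :=
  LinIso (out_corner_fwdK f) (out_corner_bwdK f).

Lemma out_off X Y (f : hom1 X Y) j : j != i ->
  lid (b Y i \c (a Y j \c (O j @1 f \c b X j))) = 0.
Proof.
move=> nji; apply: hat_inj => W w; rewrite hat0 hat_id /=.
by rewrite bout_bin0_hat // eq_sym.
Qed.

(** Dually, composed with [b Y i] the sum [N f] keeps only its [i]-th summand.  The
    axioms are easier for the inverse cells, which contract [b a] by [eps]. *)
Definition out_cell X Y (f : hom1 X Y) : liniso (O i @1 f \c b X i) (b Y i \c N @1 f) :=
  liniso_comp (liniso_inv (@single_iso _ _ _ _ _ (lwhisk_dirsum (b Y i) (s f)) i
    (@out_off _ _ f))) (out_corner f).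

Lemma out_cell_hat X Y (f : hom1 X Y) W (w : hom1 W (N X)) :
  hat (fwd (out_cell f)) w =
  (lid (b Y i) \h hat (ninj f i) w)
    \v hat (eps' (d Y) i) (O i @1 f \c b X i \c w).
Proof.
by rewrite /out_cell /= -?/(nproj _ _) -?/(ninj _ _) !(out_corner_fwd_hat, hatE)
  /= lcomp1f.
Qed.

Lemma out_cell_bwd_hat X Y (f : hom1 X Y) W (w : hom1 W (N X)) :
  hat (bwd (out_cell f)) w = hat (eps (d Y) i) (O i @1 f \c b X i \c w)
    \v (lid (b Y i) \h hat (nproj f i) w).
Proof.
by rewrite /out_cell /= -?/(nproj _ _) -?/(ninj _ _) !(out_corner_bwd_hat, hatE)
  /= lcomp1f.
Qed.

Lemma out_nat X Y (f f' : hom1 X Y) (u : f ~> f') :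
  fwd (out_cell f') \v (fmap (pfhom (O i)) u \h lid (b X i)) =
  (lid (b Y i) \h fmap (pfhom N) u) \v fwd (out_cell f).
Proof.
apply/esym; apply: (square_inv (i := liniso_inv (out_cell f))
  (j := liniso_inv (out_cell f'))) => /=.
apply: hat_inj => W w; rewrite !(out_cell_bwd_hat, hatE) /= !lcompf1 !lcomp1f.
have /= E := hat_nat (eps (d Y) i) (hat (fmap (pfhom (O i)) u) (b X i \c w)).
by rewrite lcompA -E -!lcompA -!whiskl N_map_hat.
Qed.

Lemma out_unit X :
  fwd (out_cell (id1 X)) \v (fwd (pfunit (O i) X) \h lid (b X i)) =
  (lid (b X i) \h fwd (pfunit N X))
    \v bwd (runit (b X i)) \v fwd (lunit (b X i)).
Proof.
apply: (fwd_monic (i := liniso_inv (out_cell (id1 X)))); rewrite fwdKl /=.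
apply: hat_inj => W w; rewrite !(out_cell_bwd_hat, hatE) /= !lcompf1.
have /= E := hat_nat (eps (d X) i) (hat (fwd (pfunit (O i) X)) (b X i \c w)).
rewrite lcomp1f -lcompA -whiskl N_unit_hat whiskl lcompA E -lcompA.
by rewrite eps_eta_bout // lcompf1.
Qed.

Lemma out_comp_bwd X Y Z (g : hom1 Y Z) (f : hom1 X Y) W (w : hom1 W (N X)) :
  hat (bwd (out_cell (g \c f))) w \v (lid (b Z i) \h hat (fwd (pfcomp N g f)) w) =
  hat (fwd (pfcomp (O i) g f)) (b X i \c w)
    \v (lid (O i @1 g) \h hat (bwd (out_cell f)) w)
    \v hat (bwd (out_cell g)) (N @1 f \c w).
Proof.
rewrite !out_cell_bwd_hat -lcompA -whiskl N_comp_hat.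
have /= E1 := hat_nat (nproj g i) (hat (nproj f i) w).
have /= E2 := hat_nat (eps (d Z) i)
  (hat (fwd (pfcomp (O i) g f)) (b X i \c w) \v
   (lid (O i @1 g) \h (hat (eps (d Y) i) (O i @1 f \c b X i \c w) \v
     (lid (b Y i) \h hat (nproj f i) w)))).
rewrite E1 (lcompA (lid (a Z i) \h (lid (O i @1 g) \h _))) -!whiskl.
by rewrite (lcompA (lid (a Z i) \h _)) -whiskl whiskl lcompA E2 -!lcompA.
Qed.

(** The composition axiom for invertible cells amounts to that for their
    inverses. *)
Lemma out_comp_of X Y Z (g : hom1 Y Z) (f : hom1 X Y)
    (cgf : liniso (O i @1 (g \c f) \c b X i) (b Z i \c N @1 (g \c f)))
    (cg : liniso (O i @1 g \c b Y i) (b Z i \c N @1 g))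
    (cf : liniso (O i @1 f \c b X i) (b Y i \c N @1 f)) :
  (forall W (w : hom1 W (N X)),
    hat (bwd cgf) w \v (lid (b Z i) \h hat (fwd (pfcomp N g f)) w) =
    hat (fwd (pfcomp (O i) g f)) (b X i \c w)
      \v (lid (O i @1 g) \h hat (bwd cf) w) \v hat (bwd cg) (N @1 f \c w)) ->
  fwd cgf \v (fwd (pfcomp (O i) g f) \h lid (b X i)) =
  (lid (b Z i) \h fwd (pfcomp N g f))
    \v fwd (assoc (b Z i) (N @1 g) (N @1 f))
    \v (fwd cg \h lid (N @1 f))
    \v bwd (assoc (O i @1 g) (b Y i) (N @1 f))
    \v (lid (O i @1 g) \h fwd cf)
    \v fwd (assoc (O i @1 g) (O i @1 f) (b X i)).
Proof.
move=> E; apply: (fwd_monic (i := liniso_inv cgf)); rewrite fwdKl /=.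
apply: hat_inj => W w; rewrite !hatE /= !lcompf1 !lcomp1f.
rewrite (lcomp_eql (E _ _)) -!lcompA (lcompA (hat (bwd cg) _)).
by rewrite (hat_fwdK cg) lcomp1f -whiskl (hat_fwdK cf) whisk1 lcompf1.
Qed.

Lemma out_comp X Y Z (g : hom1 Y Z) (f : hom1 X Y) :
  fwd (out_cell (g \c f)) \v (fwd (pfcomp (O i) g f) \h lid (b X i)) =
  (lid (b Z i) \h fwd (pfcomp N g f))
    \v fwd (assoc (b Z i) (N @1 g) (N @1 f))
    \v (fwd (out_cell g) \h lid (N @1 f))
    \v bwd (assoc (O i @1 g) (b Y i) (N @1 f))
    \v (lid (O i @1 g) \h fwd (out_cell f))
    \v fwd (assoc (O i @1 g) (O i @1 f) (b X i)).
Proof.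
exact: (out_comp_of (@out_comp_bwd _ _ _ g f)).
Qed.

Definition block_out : pseudonat N (O i) := PseudoNat out_nat out_unit out_comp.

End Out.

Section Modifications.
Context (i : 'I_n).
Local Notation c_in := (in_cell i).
Local Notation c_out := (out_cell i).

(** The triangle identities for [eta'] and [eps'] follow from those for [eta] and
    [eps], of which they are inverses wherever they are composed here. *)
Lemma eta'_eps' X W (w : hom1 W (O i X)) :
  hat (eta' (d X) i) (a X i \c w) \v (lid (a X i) \h hat (eps' (d X) i) w) =
  lid (a X i \c w).
Proof.
rewrite -[LHS]lcompf1 -[X in _ \v X = _](bin_eps_eta tri) -lcompA.
rewrite (lcompA (lid _ \h hat (eps' _ _) _)) -whiskl eps_sect_hat whisk1 lcomp1f.
exact: eta_sect_bin.
Qed.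

Lemma eta'_eps'_bout X W (w : hom1 W (N X)) :
  (lid (b X i) \h hat (eta' (d X) i) w) \v hat (eps' (d X) i) (b X i \c w) =
  lid (b X i \c w).
Proof.
rewrite -[LHS]lcompf1 -[X in _ \v X = _](eps_eta_bout tri) -lcompA.
rewrite (lcompA (hat (eps' _ _) _)) eps_sect_hat lcomp1f.
exact: eta_sect_bout.
Qed.

Lemma nproj_inj_hat X Y (f : hom1 X Y) W (w : hom1 W (N X)) :
  hat (nproj f i) w \v hat (ninj f i) w = lid (a Y i \c O i @1 f \c b X i \c w).
Proof. by rewrite -hat_comp /nproj /ninj dinjK hat_id. Qed.

(** The cells of the composite transformations [b a] and [a b]. *)
Definition out_in_cell X Y (f : hom1 X Y) :=
  bwd (assoc (b Y i) (a Y i) (O i @1 f))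
  \v ((lid (b Y i) \h fwd (c_in f))
  \v (fwd (assoc (b Y i) (N @1 f) (a X i))
  \v ((fwd (c_out f) \h lid (a X i))
  \v bwd (assoc (O i @1 f) (b X i) (a X i))))).

Definition in_out_cell X Y (f : hom1 X Y) :=
  bwd (assoc (a Y i) (b Y i) (N @1 f))
  \v ((lid (a Y i) \h fwd (c_out f))
  \v (fwd (assoc (a Y i) (O i @1 f) (b X i))
  \v ((fwd (c_in f) \h lid (b X i))
  \v bwd (assoc (N @1 f) (a X i) (b X i))))).

Lemma out_in_cell_hat X Y (f : hom1 X Y) W (w : hom1 W (O i X)) :
  hat (out_in_cell f) w =
  (lid (b Y i) \h hat (fwd (c_in f)) w) \v hat (fwd (c_out f)) (a X i \c w).
Proof.
rewrite /out_in_cell; move: (c_in f) (c_out f) => ci co.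
by hat_simpl.
Qed.

Lemma in_out_cell_hat X Y (f : hom1 X Y) W (w : hom1 W (N X)) :
  hat (in_out_cell f) w =
  (lid (a Y i) \h hat (fwd (c_out f)) w) \v hat (fwd (c_in f)) (b X i \c w).
Proof.
rewrite /in_out_cell; move: (c_in f) (c_out f) => ci co.
by hat_simpl.
Qed.

Lemma eps_mod X Y (f : hom1 X Y) :
  (bwd (lunit (O i @1 f)) \v fwd (runit (O i @1 f)))
    \v (lid (O i @1 f) \h eps (d X) i) =
  (eps (d Y) i \h lid (O i @1 f)) \v out_in_cell f.
Proof.
apply: hat_inj => W w; rewrite !(out_in_cell_hat, in_cell_hat, out_cell_hat, hatE) /=.
rewrite !lcompf1 ?lcomp1f.
have /= E := hat_nat (eps (d Y) i) (lid (O i @1 f) \h hat (eps (d X) i) w).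
rewrite whiskl -!lcompA (lcompA (lid (b Y i) \h hat (nproj f i) _)) -whiskl.
rewrite nproj_inj_hat whisk1 lcomp1f lcompA E -lcompA eps_idem_hat.
by rewrite -(idem_nat_hat eP) idem_bout whisk1 lcompf1.
Qed.

Lemma eps'_mod X Y (f : hom1 X Y) :
  out_in_cell f \v (lid (O i @1 f) \h eps' (d X) i) =
  (eps' (d Y) i \h lid (O i @1 f))
    \v (bwd (lunit (O i @1 f)) \v fwd (runit (O i @1 f))).
Proof.
apply: hat_inj => W w; rewrite !(out_in_cell_hat, in_cell_hat, out_cell_hat, hatE) /=.
rewrite !lcompf1 ?lcomp1f.
have /= E := hat_nat (eps' (d Y) i) (lid (O i @1 f) \h hat (eps' (d X) i) w).
rewrite whiskl -!lcompA (lcompA (lid (b Y i) \h hat (nproj f i) _)) -whiskl.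
rewrite nproj_inj_hat whisk1 lcomp1f E lcompA -!whiskl eps_idem_hat.
by rewrite (bin_O_idem eP) whisk1 lcomp1f.
Qed.

(** The projection of [N f] onto its [i]-th summand is [eta] up to the cell of
    [b]; this is what relates [eta] at [X] and at [Y]. *)
Lemma eta_nproj X Y (f : hom1 X Y) W (w : hom1 W (N X)) :
  hat (eta (d Y) i) (N @1 f \c w) =
  (lid (a Y i) \h hat (fwd (c_out f)) w) \v hat (nproj f i) w.
Proof.
have E : (lid (a Y i) \h hat (bwd (c_out f)) w) \v hat (eta (d Y) i) (N @1 f \c w)
    = hat (nproj f i) w.
  have /= E1 := hat_nat (eta (d Y) i) (hat (nproj f i) w).
  by rewrite out_cell_bwd_hat whiskl -lcompA -E1 lcompA bin_eps_eta // lcomp1f.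
by rewrite -E lcompA -whiskl (hat_bwdK (c_out f)) whisk1 lcomp1f.
Qed.

Lemma eta_mod X Y (f : hom1 X Y) :
  in_out_cell f \v (lid (N @1 f) \h eta (d X) i) =
  (eta (d Y) i \h lid (N @1 f))
    \v (bwd (lunit (N @1 f)) \v fwd (runit (N @1 f))).
Proof.
apply: hat_inj => W w; rewrite hat_comp in_out_cell_hat.
move: (c_in f) (c_out f) (in_cell_hat f (b X i \c w)) (eta_nproj f w).
move=> ci co Eci Eco; hat_simpl.
rewrite Eco -lcompA; congr (_ \v _); rewrite Eci -lcompA.
have /= -> := hat_nat (nproj f i) (hat (eta (d X) i) w).
by rewrite lcompA -!whiskl eps_eta_bout // !whisk1 lcomp1f.
Qed.

Lemma eta'_mod X Y (f : hom1 X Y) :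
  (bwd (lunit (N @1 f)) \v fwd (runit (N @1 f)))
    \v (lid (N @1 f) \h eta' (d X) i) =
  (eta' (d Y) i \h lid (N @1 f)) \v in_out_cell f.
Proof.
apply: hat_inj => W w; rewrite [RHS]hat_comp in_out_cell_hat.
move: (c_in f) (c_out f) (in_cell_bwd_hat f (b X i \c w)) (out_cell_hat i f w).
move=> ci co Eci Eco; hat_simpl.
have E1 : hat (eta' (d Y) i) (N @1 f \c w) \v
    (lid (a Y i) \h hat (fwd co) w) = hat (ninj f i) w.
  rewrite Eco whiskl lcompA.
  have /= -> := hat_nat (eta' (d Y) i) (hat (ninj f i) w).
  by rewrite -lcompA eta'_eps' lcompf1.
have E2 : (lid (N @1 f) \h hat (eta' (d X) i) w)
    \v hat (bwd ci) (b X i \c w) = hat (ninj f i) w.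
  rewrite Eci lcompA.
  have /= <- := hat_nat (ninj f i) (hat (eta' (d X) i) w).
  by rewrite -lcompA -!whiskl eta'_eps'_bout !whisk1 lcompf1.
by rewrite lcompA E1 -E2 -lcompA (hat_fwdK ci) lcompf1.
Qed.

End Modifications.

Definition psfun_blocks : blocks (C := PsFun B C) (O := O)
  (fun i => Modification (eP i) : id1 (O i : PsFun B C) ~> id1 (O i : PsFun B C)) N.
Proof.
refine (@Blocks k (PsFun B C) n O _ N block_in block_out
  (fun i => @Modification k B C N N (pn_id N) (pn_hcomp (block_in i) (block_out i))
     (fun X => eta (d X) i) (@eta_mod i))
  (fun i => @Modification k B C N N (pn_hcomp (block_in i) (block_out i)) (pn_id N)
     (fun X => eta' (d X) i) (@eta'_mod i))
  (fun i => @Modification k B C (O i) (O i) (pn_hcomp (block_out i) (block_in i))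
     (pn_id (O i)) (fun X => eps (d X) i) (@eps_mod i))
  (fun i => @Modification k B C (O i) (O i) (pn_id (O i))
     (pn_hcomp (block_out i) (block_in i)) (fun X => eps' (d X) i) (@eps'_mod i))
  _ _ _ _ _).
- by move=> i; apply: modification_eq => X; apply: eta_retr.
- apply: modification_eq => X; rewrite mod_sumE; exact: eta_sum.
- by move=> i; apply: modification_eq => X; apply: eps_sect.
- by move=> i; apply: modification_eq => X; apply: eps_idem.
- by move=> i j nij; apply: modification_eq => X; apply: (bout_bin0 (d X)).
Defined.

End BlockTransformations.

Section Existence.
Context {k : comPzRingType} {B C : bicat k}.

(** Blocks are chosen independently at each object; the values of the new
    pseudofunctor on 1-cells, being defined through them, absorb the choices. *)
Lemma psfun_blocks_exist (addC : locally_additive C) n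
    (O : 'I_n -> pseudofunctor B C)
    (e : forall i, id1 (O i : PsFun B C) ~> id1 (O i : PsFun B C)) :
  (forall X, exists T, inhabited (blocks (O := fun i => O i X)
     (fun i => mdob (e i) X : id1 (O i X) ~> id1 (O i X)) T)) ->
  exists N : PsFun B C, inhabited (blocks (C := PsFun B C) e N).
Proof.
move=> dX; pose N X := projT1 (cid (dX X)).
have d X : blocks (O := fun i => O i X)
    (fun i => mdob (e i) X : id1 (O i X) ~> id1 (O i X)) (N X).
  by apply: inhabited_witness; apply: (projT2 (cid (dX X))).
pose a X i := bin (adj_blocks (d X)) i; pose b X i := bout (adj_blocks (d X)) i.
pose st X Y (f : hom1 X Y) := dirsum_choice (@addC (N X) (N Y))
  (fun i => a Y i \c (pfhom (O i) f \c b X i)).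
pose s X Y (f : hom1 X Y) := projT2 (st X Y f).
have tri X : triangles (adj_blocks (d X)) by apply: adj_blocks_triangles.
have eP i : @is_modification _ _ _ _ _ (pn_id (O i)) (pn_id (O i))
    (fun X => mdob (e i) X) := mdP (e i).
pose NF := block_functor eP tri s.
exists NF; constructor.
have <- : (fun i => Modification (eP i)) = e.
  by apply: functional_extensionality_dep => i; apply: modification_eq.
exact: (psfun_blocks (N := NF) eP tri (s := s)
  (block_functor_map eP tri s) (block_functor_comp eP tri s)
  (block_functor_unit eP tri s)).
Qed.

End Existence.

(** * Decomposition into primitive idempotents *)
Section Primitive.
Context {k : comPzRingType} {D : lincat k} {x : D}.
Implicit Types u v p : x ~> x.

Definition primitive p : Prop :=
  [/\ p <> 0, p \v p = p
    & forall v, v \v v = v -> p \v v = v -> v = 0 \/ v = p].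

Definition orthogonal n (p : 'I_n -> (x ~> x)) : Prop :=
  forall i j, i != j -> p i \v p j = 0.

Context (T : finType) (supp : (x ~> x) -> {set T}).
Hypothesis comm : forall u v, u \v v = v \v u.
Hypothesis suppI : forall u v, u \v u = u -> v \v v = v ->
  supp (u \v v) = supp u :&: supp v.
Hypothesis supp0 : supp 0 = set0.
Hypothesis supp_eq0 : forall u, u \v u = u -> supp u = set0 -> u = 0.

Lemma lcompBl (u v w : x ~> x) : (u - v) \v w = (u \v w) - (v \v w).
Proof.
have := lcomp_linearl w (-1) v u => /=; rewrite !scaleN1r [u - v]addrC => ->.
exact: addrC.
Qed.

Lemma supp_proper u v : u \v u = u -> v \v v = v -> u \v v = v -> v <> u ->
  (#|supp v| < #|supp u|)%N.
Proof.
move=> uu vv uv nvu; have vu : v \v u = v by rewrite comm.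
have wv : (u - v) \v v = 0 by rewrite lcompBl uv vv subrr.
have ww : (u - v) \v (u - v) = u - v.
  by rewrite lcompBl (comm u) (comm v) wv subr0 lcompBl uu vu.
have wu : u \v (u - v) = u - v by rewrite comm lcompBl uu vu.
apply: proper_card; rewrite properE -{1}uv suppI // subsetIl /=.
apply/negP => suv; apply: nvu; apply/esym/eqP; rewrite -subr_eq0; apply/eqP.
apply: supp_eq0 => //; apply/eqP; rewrite -subset0 -supp0 -wv suppI //.
by rewrite subsetI subxx -wu suppI // (subset_trans _ suv) ?subsetIl.
Qed.

(** By induction on the size of the support: if [u] is not primitive, it is the sum
    of [v] and [u - v] for some idempotent [v] below it, and both have smaller
    support because their supports are disjoint and nonempty. *)
Lemma primitive_decomposition u : u \v u = u ->
  exists n (p : 'I_n -> (x ~> x)),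
    [/\ forall i, primitive (p i), orthogonal p & \sum_i p i = u].
Proof.
have [m] := ubnP #|supp u|; elim: m u => // m IH u; rewrite ltnS => lt_u uu.
have [u0|nu0] := pselect (u = 0).
  by exists 0%N, (fun _ => 0); rewrite big_ord0 u0; split=> // -[].
have [up|nup] := pselect (primitive u).
  exists 1%N, (fun _ => u); rewrite big_ord1; split=> // i j.
  by rewrite !ord1 eqxx.
have [v [vv uv nv0 nvu]] : exists v, [/\ v \v v = v, u \v v = v, v <> 0 & v <> u].
  apply: contrapT => nv; apply: nup; split=> // v vv uv.
  have [->|v0] := pselect (v = 0); [by left|right].
  by apply: contrapT => vu; apply: nv; exists v.
have vu : v \v u = v by rewrite comm.
have wv : (u - v) \v v = 0 by rewrite lcompBl uv vv subrr.
have ww : (u - v) \v (u - v) = u - v.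
  by rewrite lcompBl (comm u) (comm v) wv subr0 lcompBl uu vu.
have wu : u \v (u - v) = u - v by rewrite comm lcompBl uu vu.
have lt_v := supp_proper uu vv uv nvu.
have lt_w : (#|supp (u - v)| < #|supp u|)%N.
  apply: supp_proper => // /eqP; rewrite -subr_eq0 addrAC subrr add0r oppr_eq0.
  by move/eqP.
have [n1 [p [p_prim p_orth p_sum]]] := IH v (leq_trans lt_v lt_u) vv.
have [n2 [q [q_prim q_orth q_sum]]] := IH _ (leq_trans lt_w lt_u) ww.
have absorb n (r : 'I_n -> (x ~> x)) i : (forall i, primitive (r i)) ->
    orthogonal r -> r i \v \sum_j r j = r i.
  move=> r_prim r_orth; rewrite lcomp_sumr (bigD1 i) //= big1 ?addr0.
    by have [_ ->] := r_prim i.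
  by move=> j nji; apply: r_orth; rewrite eq_sym.
have pq i j : p i \v q j = 0.
  rewrite -(absorb _ _ i p_prim p_orth) -(absorb _ _ j q_prim q_orth).
  by rewrite p_sum q_sum (comm (q j)) -lcompA (lcompA v) (comm v) wv lcomp0l lcomp0r.
exists (n1 + n2)%N, (fun i => match split i with inl a => p a | inr b => q b end).
split=> [i|i j|].
- by case: (split i).
- rewrite -(inj_eq (can_inj (@splitK n1 n2))).
  case: (split i) (split j) => [a|a] [b|b] //= nij.
  + by apply: p_orth.
  + by rewrite comm.
  + by apply: q_orth.
- rewrite big_split_ord /= -[RHS](subrK v) [RHS]addrC -q_sum -[in RHS]p_sum.
  by congr (_ + _); apply: eq_bigr => i _;
    rewrite (unsplitK (inl _)) || rewrite (unsplitK (inr _)).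
Qed.

End Primitive.

(** * Splitting an object along orthogonal idempotents *)
Section SplitPieces.
Context {k : comPzRingType} {D : bicat k} {X : D}.
Implicit Types p : id1 X ~> id1 X.

Lemma end_id_comm (u v : id1 X ~> id1 X) : u \v v = v \v u.
Proof.
apply: hat_inj => W w; rewrite !hatE.
by have /= := hat_nat u (hat v w).
Qed.

(** The composite [bin (d i) \c bout (d j)] is zero for [i != j], since [p i] acts
    as the identity on its first factor and [p j] on the second. *)
Lemma split_dirsum n (p : 'I_n -> (id1 X ~> id1 X)) (N : 'I_n -> D)
    (d : forall i, blocks (n := 1) (O := fun _ => X) (fun _ => p i) (N i)) :
  orthogonal p -> \sum_i p i = lid (id1 X) -> object_dirsum N X.
Proof.
move=> p_orth p_sum.
exists (fun i => bout (d i) ord0), (fun i => bin (d i) ord0); split=> [i|i j nij|].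
- constructor; exists (eta' (d i) ord0) (eta (d i) ord0); first exact: eta_retr.
  by have := eta_sum (d i); rewrite big_ord1.
- exists (bin (d i) ord0 \c bout (d j) ord0); last by constructor; apply: liniso1.
  apply/zero_ob_lid; apply: hat_inj => W w; rewrite hat0 hat_id /=.
  rewrite -(whisk1 (bin (d i) ord0)) -(idem_bout (d j)) -[LHS]lcomp1f -(bin_idem (d i)).
  by rewrite -whiskl -(hat_comp (p i) (p j)) p_orth // hat0 bimap0r.
exists (id1 X); last by constructor; apply: liniso1.
apply/dirsumP; constructor.
refine (@DirsumData _ _ _ _ _ (fun i => eps (d i) ord0) (fun i => eps' (d i) ord0)
  (fun i => eps_sect (d i) ord0) _ _).
- move=> i j nij; rewrite -(eps'_idem (d i)) -(idem_eps (d j)).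
  by rewrite -lcompA (lcompA (p i)) p_orth // lcomp0l lcomp0r.
- by under eq_bigr do rewrite eps_idem.
Qed.

(** Compression embeds [End (Id_N)] into [End (Id_X)], with image in the corner of
    [p]; an idempotent of [End (Id_N)] thus gives one below [p], which is [0] or
    [p] by primitivity. *)
Lemma split_indecomposable p (N : D)
    (d : blocks (n := 1) (O := fun _ => X) (fun _ => p) N) :
  primitive p -> strongly_indecomposable N.
Proof.
move=> [p0 pp pprim].
have id0 : lid (id1 N) <> 0.
  move=> N0; apply: p0; rewrite -(eps_idem d ord0); apply: lcomp_through0.
  apply: hat_inj => W w; rewrite hat0 hat_id /= -whisk1.
  have := hat_id (nf_one N) (bin d ord0 \c w).
  by rewrite /= N0 hat0 => <-; rewrite bimap0r.
have bin_all (u v : id1 N ~> id1 N) :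
    (forall W (w : hom1 W X), hat u (bin d ord0 \c w) = hat v (bin d ord0 \c w)) ->
    u = v.
  move=> E; apply: hat_inj => W w; rewrite -[LHS]lcompf1 -[RHS]lcompf1.
  rewrite -(eta_sum_hat d w) big_ord1 !lcompA.
  have /= -> := hat_nat u (hat (eta' d ord0) w).
  have /= -> := hat_nat v (hat (eta' d ord0) w).
  by rewrite E.
split=> // [N0|u uu].
  by apply: id0; have [[_ /(_ (id1 N) (id1 N)) [f [_ fP]]] _] := N0 N;
    rewrite -(fP (lid _)) // -(fP 0).
have cc := compress_idem d ord0 uu.
have pc : p \v compress d ord0 u = compress d ord0 u.
  by rewrite /compress lcompA (idem_eps d ord0).
case: (pprim _ cc pc) => E; [left|right]; apply: bin_all => W w.
- by rewrite (compress0_bin E) hat0.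
- by rewrite (compress1_bin E) hat_id.
Qed.

End SplitPieces.

(** * Pseudofunctors into a Krull-Schmidt bicategory *)
Section PseudofunctorsIntoKrullSchmidt.
Context {k : comPzRingType} {B C : bicat k}.

Lemma psfun_additive : additive_bicat C -> additive_bicat (PsFun B C).
Proof.
move=> [locC sumC]; split; first exact: psfun_locally_additive.
move=> n O; pose e i := lid (id1 (O i : PsFun B C)).
(* A direct sum is a family of blocks all of whose idempotents are [1]. *)
have [X|N [d]] := psfun_blocks_exist locC (e := e); last first.
  by exists N; apply: blocks_dirsum.
have [T /dirsum_blocks d] := sumC n (fun i => O i X).
by exists T.
Qed.

Lemma component_idem (F : pseudofunctor B C) (u : id1 (F : PsFun B C) ~> id1 (F : PsFun B C)) X :
  u \v u = u -> (mdob u X : id1 (F X) ~> id1 (F X)) \v mdob u X = mdob u X.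
Proof. by move=> uu; rewrite -{3}uu. Qed.

(** With [f : X -> Y] an equivalence and [g] its inverse, [F g F f] is isomorphic to
    the identity of [F X], and by naturality whiskering [u X] with [F f] is
    whiskering [F f] with [u Y], which is [0]. *)
Lemma component_eq0_equiv (F : pseudofunctor B C) (u : id1 (F : PsFun B C) ~> id1 (F : PsFun B C))
    (X Y : B) : equivalent X Y ->
  (mdob u Y : id1 (F Y) ~> id1 (F Y)) = 0 -> (mdob u X : id1 (F X) ~> id1 (F X)) = 0.
Proof.
move=> [f [g [[gf] _]]] uY.
have th : liniso (pfhom F g \c pfhom F f) (id1 (F X)).
  apply: liniso_comp (liniso_inv (pfunit F X)) (liniso_comp _ (pfcomp F g f)).
  exact: (@LinIso _ _ _ _ (fmap (pfhom F) (fwd gf)) (fmap (pfhom F) (bwd gf))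
    (etrans (esym (fmapM _ _ _)) (etrans (congr1 _ (fwdK gf)) (fmap1 _ _)))
    (etrans (esym (fmapM _ _ _)) (etrans (congr1 _ (bwdK gf)) (fmap1 _ _)))).
pose uX : id1 (F X) ~> id1 (F X) := mdob u X.
apply: hat_inj => W w; rewrite hat0 -/uX.
have := hat_nat (fwd th) (hat uX w).
rewrite /= (idem_nat_hat (O := fun _ : 'I_1 => F) (e := fun _ X => mdob u X)
   (fun _ => mdP u) f (i := ord0) w) uY hat0 bimap0r lcomp0r => E.
by rewrite -[LHS]lcompf1 -(hat_bwdK th) lcompA -E lcomp0l.
Qed.

End PseudofunctorsIntoKrullSchmidt.

Theorem theorem7p14 (k : comPzRingType) (B C : bicat k) :
  krull_schmidt C -> finitely_many_classes B -> krull_schmidt (PsFun B C).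
Proof.
move=> ksC [m [A equivA]]; have [addC _] := ksC; have [locC _] := addC.
split; first exact: psfun_additive.
move=> F _.
have dec X : {n : nat & {D : 'I_n -> C &
    ((forall i, strongly_indecomposable (D i)) *
     blocks (fun i => lid (id1 (D i))) (F X))%type}}.
  have [n /cid [D [indec d]]] := cid (krull_schmidt_blocks ksC (F X)).
  by exists n, D; split=> //; apply: inhabited_witness d.
pose indec X := (projT2 (projT2 (dec X))).1.
pose d X := (projT2 (projT2 (dec X))).2.
pose E := id1 (F : PsFun B C) ~> id1 (F : PsFun B C).
pose at_ (u : E) X : id1 (F X) ~> id1 (F X) := mdob u X.
pose T : finType := {j : 'I_m & 'I_(projT1 (dec (A j)))}.
(* The support of [u] records which indecomposable summands of the values of
   [F] on the representatives [A j] are kept by the components of [u]. *)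
pose supp (u : E) : {set T} :=
  [set t : T | tagged t \in idem_support (d (A (tag t))) (at_ u (A (tag t)))].
have suppI u v : u \v u = u -> v \v v = v -> supp (u \v v) = supp u :&: supp v.
  move=> uu vv; apply/setP=> t; rewrite !inE.
  have := idem_supportI (indec _) (d (A (tag t))) (component_idem (A (tag t)) uu)
    (component_idem (A (tag t)) vv).
  by move=> /setP /(_ (tagged t)); rewrite !inE.
have supp0 : supp 0 = set0.
  apply/setP=> t; rewrite !inE; apply/asboolP => /(_ _); apply.
  exact: lcomp0l.
have supp_eq0 u : u \v u = u -> supp u = set0 -> u = 0.
  move=> uu u0; apply: modification_eq => X; have [j XAj] := equivA X.
  apply: component_eq0_equiv XAj _; rewrite (idem_support_sum (indec _) (d _) (component_idem _ uu)).
  apply: big1 => i; have /setP /(_ (Tagged (fun j => 'I_(projT1 (dec (A j)))) i : T)) := u0.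
  by rewrite !inE /= => ->.
have [n [p [p_prim p_orth p_sum]]] :=
  primitive_decomposition (@end_id_comm _ (PsFun B C) F) suppI supp0 supp_eq0
    (lcomp1f (lid (id1 (F : PsFun B C)))).
have split_p i : {N : PsFun B C &
    blocks (n := 1) (O := fun _ => F : PsFun B C) (fun _ => p i) N}.
  have /cid [N /inhabited_witness dN] :
      exists N : PsFun B C, inhabited (blocks (n := 1) (fun _ => p i) N).
    apply: psfun_blocks_exist => // X.
    have [_ pp _] := p_prim i.
    exact: (split_idem (indec X) (d X) addC (component_idem X pp)).
  by exists N.
exists n, (fun i => projT1 (split_p i)), F; split.
- by move=> i; exact: (split_indecomposable (projT2 (split_p i)) (p_prim i)).
- exact: (split_dirsum (fun i => projT2 (split_p i)) p_orth p_sum).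
- exists (id1 (F : PsFun B C)), (id1 (F : PsFun B C)).
  by split; constructor; apply: lunit.
Qed.
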